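(* For any $\lambda>0$ and $\sigma^2>0$ there exists a unique $\alpha>\alpha_{\min}$ such that $\lambda(\alpha)=\lambda$. Hence the function $\lambda\mapsto\alpha(\lambda)$, which assigns to each $\lambda\in(0,\infty)$ this unique $\alpha$, is continuous and non-decreasing, and its image $\mathcal{A}=\alpha((0,\infty))$ is of the form $(\alpha_0,\infty)$.
   Context: Here $\delta\in(0,\infty)$, $p_{X_0}$ is a probability measure on $\mathbb{R}$ with bounded second moment, $X_0\sim p_{X_0}$, and $Z\sim\mathsf{N}(0,1)$ is independent of $X_0$. Soft thresholding: $\eta(x;\theta)=x-\theta$ if $x>\theta$, $0$ if $-\theta\le x\le\theta$, $x+\theta$ if $x<-\theta$; $\eta'$ is the derivative in the first argument. Calibration: let $\phi,\Phi$ be the standard Gaussian density and distribution function. $\alpha_{\min}=\alpha_{\min}(\delta)$ is the unique non-negative solution $\alpha$ of $(1+\alpha^2)\Phi(-\alpha)-\alpha\phi(\alpha)=\delta/2$. Let $\mathsf{F}(\tau^2,\theta)=\sigma^2+\frac1\delta\mathbb{E}\{[\eta(X_0+\tau Z;\theta)-X_0]^2\}$. For $\sigma^2>0$ and $\alpha>\alpha_{\min}$ the equation $\tau^2=\mathsf{F}(\tau^2,\alpha\tau)$ has a unique solution, denoted $\tau_*=\tau_*(\alpha)$. The function $\alpha\mapsto\lambda(\alpha)$ on $(\alpha_{\min},\infty)$ is defined by $\lambda(\alpha)=\alpha\tau_*\big[1-\frac1\delta\mathbb{E}\{\eta'(X_0+\tau_*Z;\alpha\tau_* )\}\big]$ with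 $\tau_*=\tau_*(\alpha)$. *)

(* Defs.v *)
From HB Require Import structures.
From mathcomp Require Import all_boot all_order all_algebra.
From mathcomp Require Import all_classical all_reals all_analysis.
Import Order.TTheory GRing.Theory Num.Theory.
Import numFieldNormedType.Exports.

Set Implicit Arguments.
Unset Strict Implicit.
Unset Printing Implicit Defensive.

Local Open Scope classical_set_scope.
Local Open Scope ring_scope.

Definition independent_RV d (Omega : measurableType d) (R : realType)
    (P : probability Omega R) (X Y : {RV P >-> R}) : Prop :=
  forall A B : set R, measurable A -> measurable B ->
    P (X @^-1` A `&` Y @^-1` B) = (P (X @^-1` A) * P (Y @^-1` B))%E.

Section soft_thresholding.
Variable R : realType.

Definition eta (x theta : R) : R :=
  if theta < x then x - theta
  else if x < - theta then x + theta
  else 0.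

(* At the two kinks [x = theta] and [x = - theta], where [eta] is not
   differentiable, [derive1] takes an unspecified value. *)
Definition eta' (x theta : R) : R := derive1 (eta ^~ theta) x.

Definition phi (x : R) : R := normal_pdf 0 1 x.

Definition Phi (x : R) : R := fine (normal_prob 0 1 `]-oo, x]%classic).

(* The left-hand side of the equation equals 1/2 at 0 and decreases strictly
   on [0, +oo) to 0, so a (unique) non-negative solution exists exactly when
   [delta <= 1].  For [delta > 1] the default value 0 of [xget] is taken, so
   that the range [alpha > alpha_min] consists of all positive [alpha]. *)
Definition alpha_min (delta : R) : R :=
  xget 0 [set a | 0 <= a /\
                  (1 + a ^+ 2) * Phi (- a) - a * phi a = delta / 2].

End soft_thresholding.

Section calibration.
Context d (Omega : measurableType d) (R : realType) (P : probability Omega R).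
Variables (X0 Z : {RV P >-> R}) (delta sigma2 : R).

(* The first argument is the squared parameter tau ^ 2. *)
Definition F (tau2 theta : R) : R :=
  sigma2 + delta^-1 *
    fine 'E_P[fun w => (eta (X0 w + Num.sqrt tau2 * Z w) theta - X0 w) ^+ 2].

Definition tau_star (alpha : R) : R :=
  xget 0 [set tau | 0 <= tau /\ tau ^+ 2 = F (tau ^+ 2) (alpha * tau)].

Definition lambda_of (alpha : R) : R :=
  let tau := tau_star alpha in
  alpha * tau *
    (1 - delta^-1 * fine 'E_P[fun w => eta' (X0 w + tau * Z w) (alpha * tau)]).

Definition alpha_of (lambda : R) : R :=
  xget 0 [set alpha | alpha_min delta < alpha /\ lambda_of alpha = lambda].

End calibration.

(* Main.v *)
(** Fix [alpha], let [tau] solve [tau^2 = F(tau^2, alpha tau)] and put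
    [W = eta(X0 + tau Z; alpha tau) - X0].  Soft thresholding is a proximal map,
    so [W] minimizes over [L^2] the convex functional [delta G + alpha V] with
    [G(w) = sqrt(sigma^2 + E w^2 / delta) - E[Z w] / delta] and
    [V(w) = E|w + X0|].  By Stein's identity [G(W) = lambda(alpha) / alpha].
    Comparing the minimizers for two penalties shows that
    [lambda(alpha) / alpha] is nondecreasing in [alpha], so [lambda] is strictly
    increasing wherever it is positive; strict convexity of
    [w |-> sqrt(sigma^2 + E w^2 / delta)] gives uniqueness of [tau], and the
    continuity of [tau] follows.  It remains to see that [lambda(alpha)] takes
    arbitrarily large values and, near [alpha_min], arbitrarily small ones: when
    [alpha_min > 0] the risk at the origin tends to [delta], which forces [tau]
    to blow up and makes [lambda] negative. *)

Require Import Defs.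
From mathcomp Require Import all_boot all_order all_algebra.
From mathcomp Require Import all_classical all_reals all_analysis.
From mathcomp Require Import measurable_realfun ring lra.
Import Order.TTheory GRing.Theory Num.Theory.
Import numFieldNormedType.Exports.

Local Open Scope classical_set_scope.
Local Open Scope ring_scope.

Set Implicit Arguments.
Unset Strict Implicit.
Unset Printing Implicit Defensive.

(** * Gaussian integrals *)

(** No derivative of [tau] in [alpha] is taken and no minimizer is constructed. Optimality enters as
    the pointwise proximal inequality of [eta], integrated at one fixed point and tested against a
    competitor. A second fixed point as competitor gives an inequality with a gap quadratic in
    [t1 - t2], positive because sigma^2 > 0. For equal penalties this inequality and its mirror
    image force [t1 = t2]. For different ones their sum cancels [G] and orders [V], and the one with
    the smaller penalty then orders [G]. The competitor 0 bounds lambda from above in terms of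
    [tau]. The nonpositive values of lambda carry no order, since [alpha] times a negative
    nondecreasing factor need not be monotone; the inversion therefore always starts from a point
    with a positive value. When [alpha_min = 0], small values come from the factor [alpha] itself.
    Independence enters only through Stein's identity and E[X0 Z] = 0; the rest uses second moments
    and truncated moments of |Z|. *)

Section gaussian.
Variable R : realType.
Local Notation mu := (@lebesgue_measure R).
Local Notation N := (normal_prob (0 : R) 1).

Lemma phiE (x : R) : phi x = normal_peak 1 * expR (- x ^+ 2 / 2).
Proof. by rewrite /phi normal_pdfE ?oner_neq0// /normal_fun subr0 expr1n. Qed.

Lemma phi_sym (x : R) : phi (- x) = phi x.
Proof. by rewrite !phiE sqrrN. Qed.

Lemma is_derive_phi (x : R) : is_derive x 1 (@phi R) (- x * phi x).
Proof.
have -> : @phi R = fun x : R => normal_peak 1 * expR (- x ^+ 2 / 2).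
  by apply/funext => y; rewrite phiE.
apply: is_derive_eq => /=.
rewrite !scaler0 /GRing.scale /=.
by field.
Qed.

(** Since [y <= expR y] at [y = z^2 / 4], [z^2 exp(-z^2/2) <= 4 exp(-z^2/4)], a multiple of the
    Gaussian density of variance 2. *)
Lemma integrable_sqr_phi :
  mu.-integrable setT (EFin \o (fun z : R => z ^+ 2 * phi z)).
Proof.
pose s := Num.sqrt (2 : R).
have s0 : s != 0 by rewrite gt_eqF// sqrtr_gt0.
have s2 : s ^+ 2 = 2 by rewrite sqr_sqrtr.
pose C := 4 * normal_peak (1 : R) / normal_peak s.
have := @integrable_normal_pdf R 0 s.
move=> /(integrableZl measurableT C) H.
apply: le_integrable H => //.
  apply/measurable_EFinP; apply: measurable_funM => //.
  exact: measurable_normal_pdf.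
move=> z _ /=.
rewrite lee_fin normal_pdfE // /normal_fun subr0 s2 phiE.
have p1 := @normal_peak_gt0 R 1 (oner_neq0 _).
have ps := @normal_peak_gt0 R s s0.
rewrite [leLHS]ger0_norm; last first.
  by rewrite mulr_ge0 ?sqr_ge0// mulr_ge0 ?expR_ge0// ltW.
apply: le_trans (ler_norm _).
have -> : C * (normal_peak s * expR (- z ^+ 2 / (2 *+ 2))) =
  normal_peak 1 * (4 * expR (- z ^+ 2 / 4)).
  rewrite /C (_ : 2 *+ 2 = 4 :> R); last by rewrite -mulr_natr -natrM.
  by field; rewrite gt_eqF.
rewrite mulrCA ler_pM2l//.
have -> : expR (- z ^+ 2 / 2) = expR (- z ^+ 2 / 4) * expR (- z ^+ 2 / 4).
  by rewrite -expRD; congr expR; field.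
rewrite mulrA ler_pM2r ?expR_gt0// mulNr expRN -ler_pdivlMr.
  by rewrite invrK; have := expR_ge1Dx (z ^+ 2 / 4); lra.
by rewrite invr_gt0 expR_gt0.
Qed.

(** The fundamental theorem on [[u n, v n]], then dominated convergence with majorant [|f|].
    Abstract endpoints let half-lines and the whole line share one proof. *)
Lemma integral_FTC_exhaustion (f F : R -> R) (D : set R) (u v : R^nat) (l : R) :
  measurable D -> mu.-integrable D (EFin \o f) -> continuous f ->
  (forall x : R, is_derive x 1 F (f x)) ->
  (forall n, u n < v n) -> (forall n, `[u n, v n]%classic `<=` D) ->
  (forall x, D x -> \forall n \near \oo, u n <= x <= v n) ->
  F (v n) - F (u n) @[n --> \oo] --> l ->
  (\int[mu]_(x in D) (f x)%:E = l%:E)%E.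
Proof.
move=> mD fint cf dF uv uvD Duv Fl.
pose f_ n := (EFin \o f) \_ `[u n, v n]%classic.
have mf : measurable_fun setT f by exact: continuous_measurable_fun.
have [|||||_ _] := @dominated_convergence _ _ R mu D mD f_ (EFin \o f) (fun x => `|(f x)%:E|)%E.
- move=> n; apply: (@measurable_funS _ _ _ _ setT) => //.
  apply/(measurable_restrictT (EFin \o f)) => //.
  by apply/measurable_funTS/measurable_EFinP.
- by apply/measurable_funTS/measurable_EFinP.
- apply: aeW => x Dx; apply: cvg_near_cst.
  near=> n; rewrite /f_ patchE mem_set //=.
  by rewrite in_itv/=; near: n; exact: Duv.
- by have := integrable_abse fint.
- apply: aeW => x n Dx; rewrite /f_ patchE /=; case: ifP => _ //=.
  by rewrite normr0 lee_fin.
set a := (X in X @ \oo --> _).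
have -> : a = (fun n => (F (v n) - F (u n))%:E).
  apply/funext => n; rewrite /a /f_ /= -integral_mkcondr.
  rewrite setIidr; last exact: uvD.
  rewrite (@continuous_FTC2 _ f F) //.
  - exact: continuous_subspaceT.
  - have cF : continuous F.
      move=> x; apply/differentiable_continuous/derivable1_diffP.
      by have [] := dF x.
    split; [by move=> x _; have [] := dF x|apply: cvg_at_right_filter; exact: cF|apply: cvg_at_left_filter; exact: cF].
  - by move=> x _; rewrite derive1E; have [_ ->] := dF x.
move=> H.
have H' : (F (v n) - F (u n))%:E @[n --> \oo] --> l%:E by apply/cvg_EFin => //; near=> n.
exact: (cvg_unique _ H H').
Unshelve. all: by end_near.
Qed.

Lemma integral_normal_prob (f : R -> R) (U : set R) : measurable U ->
  N.-integrable U (EFin \o f) ->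
  (\int[N]_(x in U) (f x)%:E = \int[mu]_(x in U) (f x * phi x)%:E)%E.
Proof.
move=> mU fint.
have mf := measurable_int N fint.
have dom := @normal_prob_dominates R 0 1.
rewrite -(Radon_Nikodym_change_of_variables dom)//=.
have H : (\int[mu]_(x in U) (f x * phi x)%:E = \int[mu]_(x in U) ((f x)%:E * (phi x)%:E))%E.
  by apply: eq_integral => x _; rewrite EFinM.
apply: ae_eq_integral => //.
- apply: emeasurable_funM => //; apply: (measurable_int mu).
  apply: (integrableS _ _ (@subsetT _ _)) => //=.
  exact: Radon_Nikodym_integrable.
- apply: (eq_measurable_fun (fun x => (f x)%:E * (phi x)%:E)%E).
    by move=> x _; rewrite EFinM.
  apply: emeasurable_funM => //; apply/measurable_EFinP/measurable_funTS.
  exact: measurable_normal_pdf.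
- have H2 : ae_eq mu U (fun x => ((f x)%:E * (phi x)%:E)%E) (fun x => (f x * phi x)%:E).
    by apply: aeW => x _; rewrite EFinM.
  apply: ae_eq_trans H2.
  apply: ae_eqe_mul2l => /=.
  rewrite Radon_NikodymE//=.
  case: cid => /= h [h1 h2 h3].
  apply: integral_ae_eq => //=.
  + exact: integrableS h2.
  + by apply/measurable_funTS/measurable_EFinP; exact: measurable_normal_pdf.
  + by move=> E E01 mE; rewrite -h3.
Qed.

(** Nonnegativity replaces integrability, so that this version can be used to establish the
    integrability of [z^2] in the first place. *)
Lemma ge0_integral_normal_prob (f : R -> R) : measurable_fun setT f ->
  (forall x, 0 <= f x) ->
  (\int[N]_x (f x)%:E = \int[mu]_x (f x * phi x)%:E)%E.
Proof.
move=> mf f0.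
have dom := @normal_prob_dominates R 0 1.
have mfE : measurable_fun setT (EFin \o f) by exact/measurable_EFinP.
rewrite -(Radon_Nikodym_SigmaFinite.change_of_variables dom)//.
have Rint := Radon_Nikodym_SigmaFinite.f_integrable dom.
have mphi : measurable_fun setT (EFin \o @phi R).
  by apply/measurable_EFinP; exact: measurable_normal_pdf.
apply: ae_eq_integral => //.
- by apply: emeasurable_funM => //; exact: measurable_int Rint.
- apply: (eq_measurable_fun (fun x => (f x)%:E * (phi x)%:E)%E).
    by move=> x _; rewrite EFinM.
  exact: emeasurable_funM.
- have H2 : ae_eq mu setT (fun x => ((f x)%:E * (phi x)%:E)%E) (fun x => (f x * phi x)%:E).
    by apply: aeW => x _; rewrite EFinM.
  apply: ae_eq_trans H2.
  apply: ae_eqe_mul2l => /=.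
  apply: integral_ae_eq => //= E _ mE.
  by rewrite -(Radon_Nikodym_SigmaFinite.f_integral dom).
Qed.

Lemma integrable_sqr_normal : N.-integrable setT (EFin \o (fun z : R => z ^+ 2)).
Proof.
have mf : measurable_fun setT (fun z : R => z ^+ 2) by exact: measurable_funX.
apply/integrableP; split; first exact/measurable_EFinP.
under eq_integral => x _ do rewrite /= ger0_norm ?sqr_ge0//.
rewrite ge0_integral_normal_prob//; last by move=> x; exact: sqr_ge0.
have /integrableP[_] := integrable_sqr_phi.
apply: le_lt_trans; apply: ge0_le_integral => //.
- by move=> x _; rewrite lee_fin mulr_ge0 ?sqr_ge0 ?normal_pdf_ge0.
- apply/measurable_EFinP; apply: measurable_funM => //; exact: measurable_normal_pdf.
- apply/measurable_EFinP; apply: measurableT_comp => //.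
  by apply: measurable_funM => //; exact: measurable_normal_pdf.
- by move=> x _; rewrite lee_fin ler_norm.
Qed.
End gaussian.

(** * Square-integrable functions on a probability space *)

Section L2.
Context d (T : measurableType d) (R : realType) (P : probability T R).
Implicit Types f g : T -> R.

Definition L2 (f : T -> R) : Prop :=
  measurable_fun setT f /\ P.-integrable setT (EFin \o (fun x => f x ^+ 2)).

Lemma L2_measurable f : L2 f -> measurable_fun setT f.
Proof. by case. Qed.

Lemma le_Rintegrable (f g : T -> R) : measurable_fun setT f ->
  (forall x, `|f x| <= g x) -> P.-integrable setT (EFin \o g) ->
  P.-integrable setT (EFin \o f).
Proof.
move=> mf fg; apply: le_integrable => //; first exact/measurable_EFinP.
move=> x _ /=; rewrite lee_fin (le_trans (fg x)) ?ler_norm//.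
Qed.

Lemma integrable_cst_prob (c : R) : P.-integrable setT (EFin \o (fun=> c)).
Proof. exact: finite_measure_integrable_cst. Qed.

Lemma integrableD_EFin (f g : T -> R) : P.-integrable setT (EFin \o f) ->
  P.-integrable setT (EFin \o g) ->
  P.-integrable setT (EFin \o (fun x => f x + g x)).
Proof. by move=> hf hg; have := integrableD measurableT hf hg. Qed.

Lemma integrableZl_EFin (c : R) (f : T -> R) : P.-integrable setT (EFin \o f) ->
  P.-integrable setT (EFin \o (fun x => c * f x)).
Proof. by move=> hf; have := integrableZl measurableT c hf. Qed.

Lemma integrableB_EFin (f g : T -> R) : P.-integrable setT (EFin \o f) ->
  P.-integrable setT (EFin \o g) ->
  P.-integrable setT (EFin \o (fun x => f x - g x)).
Proof. by move=> hf hg; have := integrableB measurableT hf hg. Qed.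

Lemma integrable_normr (f : T -> R) : P.-integrable setT (EFin \o f) ->
  P.-integrable setT (EFin \o (fun x => `|f x|)).
Proof. by move=> hf; have := integrable_abse hf. Qed.

Lemma L2_le f g : measurable_fun setT f -> (forall x, `|f x| <= `|g x|) ->
  L2 g -> L2 f.
Proof.
move=> mf fg [mg ig]; split => //.
apply: le_Rintegrable ig; first exact: measurable_funX.
by move=> x; rewrite normrX -[leRHS]real_normK ?num_real// ler_pXn2r ?nnegrE.
Qed.

Lemma L2M f g : L2 f -> L2 g -> P.-integrable setT (EFin \o (fun x => f x * g x)).
Proof.
move=> [mf intf] [mg intg].
apply: (@le_Rintegrable _ (fun x => f x ^+ 2 + g x ^+ 2)).
- exact: measurable_funM.
- move=> x; rewrite normrM -[f x ^+ 2]real_normK ?num_real//.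
  rewrite -[g x ^+ 2]real_normK ?num_real//.
  by have := sqr_ge0 (`|f x| - `|g x|); nra.
- exact: integrableD_EFin.
Qed.

Lemma L2_cst c : L2 (fun=> c).
Proof. by split => //; exact: integrable_cst_prob. Qed.

Lemma L2_integrable f : L2 f -> P.-integrable setT (EFin \o f).
Proof.
move=> hf; have := L2M hf (L2_cst 1); congr (_.-integrable _ _).
by apply/funext => x /=; rewrite mulr1.
Qed.

Lemma L2Z c f : L2 f -> L2 (fun x => c * f x).
Proof.
move=> [mf hf]; split; first exact: measurable_funM.
have := integrableZl_EFin (c ^+ 2) hf; congr (_.-integrable _ _).
by apply/funext => x /=; rewrite exprMn.
Qed.

Lemma L2D f g : L2 f -> L2 g -> L2 (fun x => f x + g x).
Proof.
move=> hf hg; split; first by apply: measurable_funD; apply: L2_measurable.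
have h1 := integrableZl_EFin 2 (L2M hf hg).
have := integrableD_EFin (integrableD_EFin hf.2 h1) hg.2.
congr (_.-integrable _ _); apply/funext => x /=.
by congr EFin; ring.
Qed.

Lemma L2B f g : L2 f -> L2 g -> L2 (fun x => f x - g x).
Proof.
move=> hf /(L2Z (-1)) hg; have := L2D hf hg.
by congr L2; apply/funext => x; rewrite mulN1r.
Qed.

Lemma L2_normr f : L2 f -> L2 (fun x => `|f x|).
Proof.
move=> hf; apply: (L2_le _ _ hf); last by move=> x; rewrite normr_id.
by apply: measurableT_comp => //; case: hf.
Qed.

Lemma L2_maxr f g : L2 f -> L2 g -> L2 (fun x => Num.max (f x) (g x)).
Proof.
move=> hf hg.
apply: (L2_le _ _ (L2D (L2_normr hf) (L2_normr hg))).
  by apply: measurable_maxr; apply: L2_measurable.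
move=> x; rewrite [leRHS]ger0_norm ?addr_ge0//.
by case: (leP (f x) (g x)) => _; [rewrite lerDr|rewrite lerDl].
Qed.

Lemma L2_bounded (C : R) f : measurable_fun setT f -> (forall x, `|f x| <= C) ->
  L2 f.
Proof.
move=> mf fC; apply: (L2_le mf _ (L2_cst C)) => x.
by apply: (le_trans (fC x)); exact: ler_norm.
Qed.

Lemma le_expect f g : P.-integrable setT (EFin \o f) ->
  P.-integrable setT (EFin \o g) -> (forall x, f x <= g x) ->
  \int[P]_x f x <= \int[P]_x g x.
Proof. by move=> hf hg fg; apply: le_Rintegral. Qed.

Lemma expectD f g : P.-integrable setT (EFin \o f) ->
  P.-integrable setT (EFin \o g) ->
  \int[P]_x (f x + g x) = \int[P]_x f x + \int[P]_x g x.
Proof. exact: RintegralD. Qed.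

Lemma expectB f g : P.-integrable setT (EFin \o f) ->
  P.-integrable setT (EFin \o g) ->
  \int[P]_x (f x - g x) = \int[P]_x f x - \int[P]_x g x.
Proof. exact: RintegralB. Qed.

Lemma expectZ c f : P.-integrable setT (EFin \o f) ->
  \int[P]_x (c * f x) = c * \int[P]_x f x.
Proof. by move=> hf; apply: RintegralZl. Qed.

Lemma expect_cst (c : R) : \int[P]_x c = c.
Proof.
rewrite Rintegral_cst// -[RHS]mulr1; congr (_ * _).
by rewrite [X in fine X](@probability_setT _ _ _ P).
Qed.

Lemma expect_ge0 f : (forall x, 0 <= f x) -> 0 <= \int[P]_x f x.
Proof. by move=> f0; apply: Rintegral_ge0. Qed.

End L2.

(** * Gaussian integration by parts for affine functions *)

Section gaussian.
Variable R : realType.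
Local Notation mu := (@lebesgue_measure R).
Local Notation N := (normal_prob (0 : R) 1).

Lemma phi_gt0 (x : R) : 0 < phi x.
Proof. by rewrite phiE mulr_gt0 ?expR_gt0 ?normal_peak_gt0 ?oner_neq0. Qed.

(** From [1 + y <= expR y], [phi z <= 2 * normal_peak 1 / z^2], while the affine factor is at most a
    multiple of [|z|]. This crude rate is enough to kill the boundary terms at infinity. *)
Lemma phi_affine_decay (c0 c1 : R) : exists2 C, 0 <= C & forall z : R, 1 <= `|z| ->
  `|(c0 + c1 * z) * phi z| <= C * `|z|^-1.
Proof.
exists (2 * normal_peak 1 * (`|c0| + `|c1|)).
  by rewrite mulr_ge0 ?addr_ge0// mulr_ge0 ?normal_peak_ge0.
move=> z z1.
have z0 : 0 < `|z| by apply: lt_le_trans z1.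
have p0 := @normal_peak_gt0 R 1 (oner_neq0 _).
rewrite normrM (gtr0_norm (phi_gt0 z)).
have h1 : `|c0 + c1 * z| <= (`|c0| + `|c1|) * `|z|.
  apply: (le_trans (ler_normD _ _)); rewrite normrM mulrDl lerD2r.
  by rewrite ler_peMr.
have h2 : phi z <= 2 * normal_peak 1 * (`|z|^-1 * `|z|^-1).
  have -> : 2 * normal_peak 1 * (`|z|^-1 * `|z|^-1) = normal_peak 1 * (z ^+ 2 / 2)^-1.
    by rewrite -[z ^+ 2]real_normK ?num_real//; field; rewrite gt_eqF.
  rewrite phiE ler_pM2l// mulNr expRN.
  rewrite lef_pV2 ?posrE ?expR_gt0//; last first.
    by rewrite -[z ^+ 2]real_normK ?num_real//; rewrite mulr_gt0 ?exprn_gt0 ?invr_gt0.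
  by have := expR_ge1Dx (z ^+ 2 / 2); lra.
apply: le_trans (ler_pM _ _ h1 h2) _ => //; first exact: ltW (phi_gt0 z).
rewrite le_eqVlt; apply/orP; left; apply/eqP.
by field; rewrite gt_eqF.
Qed.

Lemma cvg_affine_phi (c0 c1 : R) (w : R^nat) : (forall n, n.+1%:R <= `|w n|) ->
  (c0 + c1 * w n) * phi (w n) @[n --> \oo] --> 0.
Proof.
move=> hw; have [C C0 hC] := phi_affine_decay c0 c1.
apply: norm_cvg0.
have h1 : \forall n \near \oo,
    0 <= `|(c0 + c1 * w n) * phi (w n)| <= C * n.+1%:R^-1.
  apply: nearW => n; rewrite normr_ge0/=.
  have w1 : 1 <= `|w n| by apply: le_trans (hw n); rewrite ler1n.
  apply: (le_trans (hC _ w1)); apply: ler_wpM2l => //.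
  by rewrite lef_pV2 ?posrE// (lt_le_trans _ w1).
have h3 : C * n.+1%:R^-1 @[n --> \oo] --> (0 : R).
  rewrite -[X in _ --> X](mulr0 C).
  by apply: cvgM; [exact: cvg_cst|exact: cvg_harmonic].
exact: (squeeze_cvgr h1 (cvg_cst _) h3).
Qed.

Lemma L2_id_normal : L2 N (@id R).
Proof. by split => //; exact: integrable_sqr_normal. Qed.

(** With [h = c0 + c1 z], the integrand [(z h - h') phi] has the primitive [- h phi]. Affine [h]
    covers all the truncated moments computed below. *)
Let dphi (c0 c1 x : R) :
  is_derive x 1 (fun z => - ((c0 + c1 * z) * phi z)) ((x * (c0 + c1 * x) - c1) * phi x).
Proof.
have d1 := is_derive_phi x.
apply: is_derive_eq.
by rewrite /GRing.scale /=; ring.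
Qed.

Let affine_integrable (c0 c1 : R) :
  N.-integrable setT (EFin \o (fun z : R => z * (c0 + c1 * z) - c1)).
Proof.
apply: integrableB_EFin; last exact: integrable_cst_prob.
apply: L2M; first exact: L2_id_normal.
by apply: L2D; [exact: L2_cst|apply: L2Z; exact: L2_id_normal].
Qed.

Let affine_phi_integrable (c0 c1 : R) :
  mu.-integrable setT (EFin \o (fun z : R => (z * (c0 + c1 * z) - c1) * phi z)).
Proof.
have i2 := @integrable_sqr_phi R.
have i0 : mu.-integrable setT (EFin \o @phi R) by exact: integrable_normal_pdf.
have mphi : measurable_fun setT (@phi R) by exact: measurable_normal_pdf.
have := integrableD measurableT (integrableZl measurableT (`|c0| + `|c1|) i2)
   (integrableZl measurableT (`|c0| + `|c1|) i0).
apply: le_integrable => //.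
  apply/measurable_EFinP; apply: measurable_funM => //.
  apply: measurable_funB => //; apply: measurable_funM => //.
  by apply: measurable_funD => //; exact: measurable_funM.
move=> z _ /=; rewrite lee_fin normrM (gtr0_norm (phi_gt0 z)).
apply: le_trans (ler_norm _).
rewrite mulrA -mulrDl ler_pM2r ?phi_gt0//.
apply: (@le_trans _ _ (`|c0| * `|z| + `|c1| * `|z| ^+ 2 + `|c1|)).
  rewrite (_ : z * _ - _ = c0 * z + c1 * z ^+ 2 - c1); last by ring.
  apply: (le_trans (ler_normB _ _)); rewrite lerD2r.
  by apply: (le_trans (ler_normD _ _)); rewrite normrM (normrM c1) normrX.
rewrite -[z ^+ 2]real_normK ?num_real//.
have := normr_ge0 c0; have := normr_ge0 c1; have := normr_ge0 z.
by have := sqr_ge0 (`|z| - 1); nra.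
Qed.

Lemma integral_normal_affine_ge (c0 c1 a : R) :
  (\int[N]_(z in `[a, +oo[) (z * (c0 + c1 * z) - c1)%:E =
   ((c0 + c1 * a) * phi a)%:E)%E.
Proof.
rewrite integral_normal_prob//; last first.
  by apply: integrableS (affine_integrable c0 c1).
pose f z := (z * (c0 + c1 * z) - c1) * phi z.
pose F z := - ((c0 + c1 * z) * phi z).
apply: (@integral_FTC_exhaustion R f F _ (fun=> a) (fun n => `|a| + n.+1%:R)
  ((c0 + c1 * a) * phi a)).
- exact: measurable_itv.
- by apply: integrableS (affine_phi_integrable c0 c1).
- move=> x; apply: cvgM; last exact: continuous_normal_pdf.
  apply: cvgB; last exact: cvg_cst.
  apply: cvgM; first exact: cvg_id.
  by apply: cvgD; [exact: cvg_cst|apply: cvgM; [exact: cvg_cst|exact: cvg_id]].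
- exact: dphi.
- by move=> n; apply: (le_lt_trans (ler_norm a)); rewrite ltrDl.
- by move=> n x /=; rewrite !in_itv/= => /andP[-> _].
- move=> x; rewrite /= in_itv/= andbT => ax; near=> n; rewrite ax/=.
  apply: (@le_trans _ _ n%:R).
    by apply/ltW; near: n; exact: nbhs_infty_gtr.
  by rewrite (@le_trans _ _ n.+1%:R) ?ler_nat// lerDr.
- rewrite /F; apply: (@cvg_trans _ (((c0 + c1 * a) * phi a - (c0 + c1 * (`|a| + n.+1%:R)) * phi (`|a| + n.+1%:R)) @[n --> \oo])).
    by apply: near_eq_cvg; near=> n; rewrite opprK addrC.
  have H : (c0 + c1 * a) * phi a - (c0 + c1 * (`|a| + n.+1%:R)) * phi (`|a| + n.+1%:R)
      @[n --> \oo] --> (c0 + c1 * a) * phi a - 0.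
    apply: cvgB; first exact: cvg_cst.
    apply: cvg_affine_phi => n.
    by rewrite ger0_norm ?addr_ge0// lerDr.
  by rewrite subr0 in H.
Unshelve. all: by end_near.
Qed.

Lemma integral_normal_affine (c0 c1 : R) :
  (\int[N]_z (z * (c0 + c1 * z) - c1)%:E = 0)%E.
Proof.
rewrite integral_normal_prob//.
pose f z := (z * (c0 + c1 * z) - c1) * phi z.
pose F z := - ((c0 + c1 * z) * phi z).
apply: (@integral_FTC_exhaustion R f F setT (fun n => - n.+1%:R)
  (fun n => n.+1%:R) 0).
- exact: measurableT.
- exact: affine_phi_integrable.
- move=> x; apply: cvgM; last exact: continuous_normal_pdf.
  apply: cvgB; last exact: cvg_cst.
  apply: cvgM; first exact: cvg_id.
  by apply: cvgD; [exact: cvg_cst|apply: cvgM; [exact: cvg_cst|exact: cvg_id]].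
- exact: dphi.
- by move=> n; apply: (@lt_trans _ _ 0); rewrite ?oppr_lt0 ltr0Sn.
- exact: (fun n => @subsetT _ _).
- move=> x _; near=> n; rewrite -ler_norml.
  apply: (@le_trans _ _ n%:R); last by rewrite ler_nat.
  by apply/ltW; near: n; exact: nbhs_infty_gtr.
- rewrite /F -[X in _ --> X]subr0; apply: cvgB.
    rewrite -[X in _ --> X]oppr0; apply: cvgN; apply: cvg_affine_phi => n.
    by rewrite ger0_norm.
  rewrite -[X in _ --> X]oppr0; apply: cvgN; apply: cvg_affine_phi => n.
  by rewrite normrN ger0_norm.
Unshelve. all: by end_near.
Qed.
End gaussian.

Ltac l2 := repeat first
  [ solve [trivial] | exact: L2_cst | exact: L2_id_normal | apply: L2B | apply: L2D | apply: L2Z | apply: L2_normr | apply: L2_maxr ].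
Ltac integ := repeat first
  [ solve [trivial] | exact: integrable_cst_prob | apply: integrableB_EFin | apply: integrableD_EFin
  | apply: integrableZl_EFin | solve [apply: L2_integrable; l2] | solve [apply: L2M; l2] | solve [apply: integrable_normr; integ]].

(** * Gaussian tails and moments of ramps *)

Section gaussian.
Variable R : realType.
Local Notation mu := (@lebesgue_measure R).
Local Notation N := (normal_prob (0 : R) 1).
Local Notation ind a := (\1_(`[a, +oo[%classic) : R -> R).
Implicit Types a b x z : R.

Lemma indcyE a z : ind a z = if a <= z then 1 else 0.
Proof. by rewrite indicE mem_setE in_itv/= andbT; case: ifP. Qed.

Lemma measurable_indcy a : measurable_fun setT (ind a).
Proof. exact: measurable_indic. Qed.

Lemma L2_indcy a : L2 N (ind a).
Proof.
apply: (@L2_bounded _ _ _ _ 1); first exact: measurable_indcy.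
by move=> z; rewrite indcyE; case: (a <= z); rewrite ?normr1 ?normr0.
Qed.

(** The upper tail [Phi (- a)] (see [Phi_gtail]), written as an expectation so that it combines with
    the other moments. *)
Definition gtail a : R := \int[N]_z ind a z.

Lemma expect_normal_affine (c0 c1 a : R) :
  \int[N]_z ((z * (c0 + c1 * z) - c1) * ind a z) = (c0 + c1 * a) * phi a.
Proof.
have := integral_normal_affine_ge c0 c1 a.
rewrite integral_mkcond => /(congr1 fine) /= <-.
congr fine; apply: eq_integral => z _.
rewrite patchE indicE; case: ifP => _; rewrite ?mulr1 ?mulr0//.
Qed.

Lemma expect_id_tail a : \int[N]_z (z * ind a z) = phi a.
Proof.
rewrite -[RHS]mul1r -[in RHS](addr0 1) -[X in 1 + X](mul0r a).
rewrite -expect_normal_affine; apply: eq_Rintegral => z _.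
by congr (_ * _); ring.
Qed.

(** Integration by parts with the affine function [z - a], whose boundary term vanishes at [a]. *)
Lemma expect_mul_pos a : \int[N]_z (z * Num.max (z - a) 0) = gtail a.
Proof.
have H := expect_normal_affine (- a) 1 a.
rewrite mul1r addNr mul0r in H.
apply/eqP; rewrite -subr_eq0 -[X in _ == X]H /gtail -expectB; last 2 first.
- by apply: L2M; l2.
- by apply: L2_integrable; exact: L2_indcy.
apply/eqP; apply: eq_Rintegral => z _.
rewrite indcyE; case: (leP a z) => az.
  by rewrite max_l ?subr_ge0//; ring.
by rewrite max_r ?subr_le0 ?ltW//; ring.
Qed.

Lemma expect_pos a : \int[N]_z (Num.max (z - a) 0) = phi a - a * gtail a.
Proof.
have hi := L2_indcy a.
rewrite -expect_id_tail -expectZ; last by integ.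
rewrite -expectB; last 2 first.
- by apply: L2M; l2.
- by integ.
apply: eq_Rintegral => z _; rewrite indcyE; case: (leP a z) => az.
  by rewrite max_l ?subr_ge0//; ring.
by rewrite max_r ?subr_le0 ?ltW//; ring.
Qed.

Lemma expect_normal_id : \int[N]_z z = 0.
Proof.
transitivity (\int[N]_z (z * (1 + 0 * z) - 0)).
  by apply: eq_Rintegral => z _; ring.
by rewrite /Rintegral integral_normal_affine.
Qed.

Lemma expect_normal_sqr : \int[N]_z (z * z) = 1.
Proof.
have H : \int[N]_z (z * z - 1) = 0.
  transitivity (\int[N]_z (z * (0 + 1 * z) - 1)).
    by apply: eq_Rintegral => z _; ring.
  by rewrite /Rintegral integral_normal_affine.
rewrite expectB in H; last 2 first.
- by integ.
- by integ.
by rewrite expect_cst in H; lra.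
Qed.

(** A vanishing tail would make [z * ind a z] zero almost everywhere, yet its expectation is
    [phi a > 0]. *)
Lemma gtail_gt0 a : 0 < gtail a.
Proof.
rewrite lt_neqAle expect_ge0 ?andbT; last by move=> z; rewrite indcyE; case: ifP.
apply/eqP => g0; have := phi_gt0 a.
rewrite -expect_id_tail.
have hi := L2_indcy a.
suff -> : \int[N]_z (z * ind a z) = 0 by rewrite ltxx.
have N0 : (\int[N]_z (ind a z)%:E = 0)%E.
  have := integrable_fin_num measurableT (L2_integrable hi).
  by move=> /fineK <-; rewrite -[fine _]/(gtail a) -g0.
rewrite /Rintegral (ae_eq_integral (cst 0%E)) ?integral0//.
- by apply/measurable_EFinP; apply: measurable_funM => //; exact: measurable_indcy.
- have : (\int[N]_z `|(ind a z)%:E| = 0)%E.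
    by rewrite -[RHS]N0; apply: eq_integral => z _; rewrite gee0_abs// lee_fin indcyE; case: ifP.
  have mi : measurable_fun setT (EFin \o ind a) by apply/measurable_EFinP; exact: measurable_indcy.
  move=> H0; have := (ae_eq_integral_abs N measurableT mi).1 H0.
  apply: filterS => z /= h _; have [->] := h I.
  by rewrite mulr0.
Qed.

Lemma Phi_gtail a : Phi (- a) = gtail a.
Proof.
have cphi : continuous (@phi R) by exact: continuous_normal_pdf.
rewrite /Phi /gtail /Rintegral integral_indic// setIT; congr fine.
rewrite /normal_prob -/(@phi R).
rewrite (@ge0_integration_by_substitutionNy R (@phi R) a); last 2 first.
- exact: continuous_subspaceT.
- by move=> x _; exact: normal_pdf_ge0.
by apply: eq_integral => x _; congr EFin; exact: phi_sym.
Qed.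

Lemma gtailN a : gtail (- a) = 1 - gtail a.
Proof.
rewrite -Phi_gtail opprK.
have -> : Phi a = fine (N `]-oo, a[%classic).
  rewrite /Phi /normal_prob; congr fine; rewrite integral_itv_bndo_bndc//.
  by apply/measurable_EFinP/measurable_funTS; exact: measurable_normal_pdf.
rewrite /gtail /Rintegral integral_indic// setIT.
rewrite -setCitvr probability_setC//.
by rewrite fineB//; exact: fin_num_measure.
Qed.
End gaussian.

(** * Soft thresholding *)

Section eta.
Variable R : realType.
Implicit Types x y z th a b : R.

Lemma etaE x th : 0 <= th ->
  eta x th = Num.max (x - th) 0 - Num.max (- x - th) 0.
Proof.
move=> th0; rewrite /eta; case: ltP => h1.
  rewrite max_l ?subr_ge0 ?ltW// max_r ?subr0// subr_le0; lra.
case: ltP => h2.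
  by rewrite max_r ?subr_le0// max_l ?subr_ge0; lra.
by rewrite !max_r; lra.
Qed.

Lemma norm_eta x th : 0 <= th -> `|eta x th| = Num.max (`|x| - th) 0.
Proof.
move=> th0; rewrite /eta; case: ltP => h1.
  by rewrite max_l; rewrite !gtr0_norm//; lra.
case: ltP => h2.
  by rewrite max_l; rewrite !ltr0_norm//; lra.
by rewrite normr0 max_r// subr_le0 ler_norml h1 h2.
Qed.

(** Where it is nonzero, [eta] is [x] moved by [th] towards 0. This reduces the second moment of
    [eta] to moments accessible by integration by parts. *)
Lemma sqr_eta x th : 0 <= th -> eta x th ^+ 2 = x * eta x th - th * `|eta x th|.
Proof.
move=> th0; rewrite /eta; case: ltP => h1.
  by rewrite ger0_norm; [ring|lra].
case: ltP => h2.
  by rewrite ltr0_norm; [ring|lra].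
by rewrite normr0; ring.
Qed.

Lemma eta_lipschitz x th y th' : 0 <= th -> 0 <= th' ->
  `|eta x th - eta y th'| <= `|x - y| + `|th - th'|.
Proof.
move=> h1 h2; have n1 := ler_norm (x - y); have n2 := ler_norm (th - th').
have := ler_norm (- (x - y)); have := ler_norm (- (th - th')).
rewrite !normrN => n3 n4; rewrite /eta ler_norml.
by case: (ltP th x) => ?; case: (ltP th' y) => ?;
  (try case: (ltP x (- th)) => ?); (try case: (ltP y (- th')) => ?); lra.
Qed.

Lemma eta_scale (t x th : R) : 0 <= t -> eta (t * x) (t * th) = t * eta x th.
Proof.
rewrite le_eqVlt => /predU1P[<-|t0].
  by rewrite !mul0r /eta oppr0 ltxx.
rewrite /eta -mulrN !ltr_pM2l//.
by case: ifP => _; [ring|case: ifP => _; ring].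
Qed.

Lemma eta_sub_norm x th : 0 <= th -> `|eta x th - x| <= th.
Proof.
by move=> h; rewrite /eta ler_norml; case: ltP => ?; [|case: ltP => ?]; lra.
Qed.

(* Optimality of [eta u th] for [y |-> (y - u)^2 / 2 + th |y|]. *)
Lemma eta_prox u th y : 0 <= th ->
  0 <= (eta u th - u) * (y - eta u th) + th * (`|y| - `|eta u th|).
Proof.
move=> th0; have := ler_norm y; have := ler_norm (- y); rewrite normrN => n1 n2.
rewrite /eta; case: ltP => h1.
  rewrite [`|u - th|]ger0_norm; last lra.
  by have := mulr_ge0 th0 (_ : 0 <= `|y| - y); rewrite subr_ge0 => /(_ n2); lra.
case: ltP => h2.
  rewrite [`|u + th|]ltr0_norm; last lra.
  by have := mulr_ge0 th0 (_ : 0 <= `|y| - - y); rewrite subr_ge0 => /(_ n1); lra.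
rewrite normr0 !subr0 sub0r.
have : `|u * y| <= th * `|y| by rewrite normrM ler_wpM2r// ler_norml h1 h2.
rewrite ler_norml; lra.
Qed.

Lemma measurable_eta d (T : measurableType d) (f : T -> R) th : 0 <= th ->
  measurable_fun setT f -> measurable_fun setT (fun w => eta (f w) th).
Proof.
move=> th0 mf; under eq_fun do rewrite etaE//.
apply: measurable_funB; apply: measurable_maxr => //.
  exact: measurable_funB.
by apply: measurable_funB => //; exact: measurableT_comp.
Qed.

Lemma eta'E y th : 0 <= th -> y != th -> y != - th ->
  eta' y th = if th < `|y| then 1 else 0.
Proof.
move=> th0 yt yNt; rewrite /eta' derive1E.
have [h1|h1|h1] := ltgtP th y.
- rewrite (lt_le_trans h1 (ler_norm _)).
  rewrite (@near_eq_derive _ _ _ _ (fun x => x - th)).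
    by rewrite derive_val ?oppr0 ?addr0.
  near=> x; rewrite /eta ifT//; near: x; exact: lt_nbhsr.
- have [h2|h2|h2] := ltgtP y (- th).
  + rewrite ltr0_norm; last lra.
    rewrite ifT; last lra.
    rewrite (@near_eq_derive _ _ _ _ (fun x => x + th)).
      by rewrite derive_val ?oppr0 ?addr0.
    near=> x; rewrite /eta.
    have -> : (x < - th) by near: x; exact: lt_nbhsl.
    rewrite ifF//; apply/negbTE; rewrite -leNgt.
    by apply/ltW; near: x; exact: lt_nbhsl.
  + rewrite ifF; last by apply/negbTE; rewrite -leNgt ler_norml; lra.
    rewrite (@near_eq_derive _ _ _ _ (cst 0)).
      by rewrite derive_val.
    near=> x; rewrite /eta.
    rewrite ifF; last first.
      by apply/negbTE; rewrite -leNgt; apply/ltW; near: x; exact: lt_nbhsl.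
    rewrite ifF//.
    by apply/negbTE; rewrite -leNgt; apply/ltW; near: x; exact: lt_nbhsr.
  + by rewrite h2 eqxx in yNt.
- by rewrite h1 eqxx in yt.
Unshelve. all: by end_near.
Qed.

(** Only the two kinks escape [eta'E]; whatever values [eta'] takes there, they enter as constants
    on two single points. *)
Lemma measurable_eta' th : 0 <= th -> measurable_fun setT (fun y : R => eta' y th).
Proof.
move=> th0.
have -> : (fun y : R => eta' y th) = (fun y => if y == th then eta' th th else
   if y == - th then eta' (- th) th else if th < `|y| then 1 else 0).
  apply/funext => y; case: eqVneq => [->//|h1]; case: eqVneq => [->//|h2].
  exact: eta'E.
apply: measurable_fun_ifT => //; first exact: measurable_fun_eqr.
apply: measurable_fun_ifT => //; first exact: measurable_fun_eqr.
apply: measurable_fun_ifT => //; apply: measurable_fun_ltr => //.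
Qed.

Lemma eta'_bounded th : 0 <= th -> exists C, forall y, `|eta' y th| <= C.
Proof.
move=> th0; exists (`|eta' th th| + `|eta' (- th) th| + 1) => y.
have n1 := normr_ge0 (eta' th th); have n2 := normr_ge0 (eta' (- th) th).
have [->|h1] := eqVneq y th; first lra.
have [->|h2] := eqVneq y (- th); first lra.
by rewrite eta'E//; case: ifP => _; rewrite ?normr1 ?normr0; lra.
Qed.
End eta.

(** * Soft thresholding of a Gaussian: Stein's identity and the risk at the origin *)

Section gaussian_eta.
Variable R : realType.
Local Notation mu := (@lebesgue_measure R).
Local Notation N := (normal_prob (0 : R) 1).
Local Notation ind a := (\1_(`[a, +oo[%classic) : R -> R).
Implicit Types a b x z th t : R.

(** The negative ramp is reflected by [max (- y) 0 = max y 0 - y], so that only ramps to the right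
    remain and [expect_mul_pos] applies. *)
Lemma eta_affine x t th z : 0 < t -> 0 <= th ->
  eta (x + t * z) th = t * (Num.max (z - (th - x) / t) 0
     - Num.max (z - - ((th + x) / t)) 0 + (z + (th + x) / t)).
Proof.
move=> t0 th0; rewrite etaE//.
have tm (u : R) : t * Num.max u 0 = Num.max (t * u) 0.
  case: (leP 0 u) => hu.
    by rewrite !max_l// mulr_ge0// ltW.
  by rewrite !max_r ?mulr0// ?pmulr_rle0// ltW.
rewrite mulrDr mulrBr !tm opprK.
have -> : t * (z - (th - x) / t) = x + t * z - th by field; rewrite gt_eqF.
have -> : t * (z + (th + x) / t) = x + t * z + th by field; rewrite gt_eqF.
rewrite -[RHS]addrA; congr (_ + _).
case: (leP 0 (x + t * z + th)) => h.
  by rewrite max_r; lra.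
by rewrite max_l; lra.
Qed.

Lemma expect_id_eta x t th : 0 < t -> 0 <= th ->
  \int[N]_z (z * eta (x + t * z) th) =
  t * (gtail ((th - x) / t) - gtail (- ((th + x) / t)) + 1).
Proof.
move=> t0 th0; set a := (th - x) / t; set b := (th + x) / t.
transitivity (\int[N]_z (t * (z * Num.max (z - a) 0 - z * Num.max (z - - b) 0 + (z * z + b * z)))).
  by apply: eq_Rintegral => z _; rewrite eta_affine// -/a -/b; ring.
have i1 c : N.-integrable setT (EFin \o (fun z => z * Num.max (z - c) 0)).
  by integ.
have i2 : N.-integrable setT (EFin \o (fun z => z * z)) by integ.
have i3 : N.-integrable setT (EFin \o (@id R)) by integ.
rewrite expectZ; last by integ.
rewrite expectD; [|by integ|by integ].
rewrite expectB; [|by integ|by integ].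
rewrite expectD; [|by integ|by integ].
rewrite expectZ; last by integ.
by rewrite !expect_mul_pos expect_normal_sqr expect_normal_id mulr0 addr0.
Qed.

Lemma expect_eta' x t th : 0 < t -> 0 <= th ->
  \int[N]_z eta' (x + t * z) th =
  gtail ((th - x) / t) - gtail (- ((th + x) / t)) + 1.
Proof.
move=> t0 th0; set a := (th - x) / t; set b := (th + x) / t.
have ia c := L2_indcy c.
(* Above [th] both indicators are 1, between the kinks only the second, below [- th] neither: the
   combination is 1, 0, 1, as [eta'] is off the kinks. *)
transitivity (\int[N]_z (ind a z - ind (- b) z + 1)); last first.
  rewrite expectD; [|by integ|by integ].
  by rewrite expectB ?expect_cst//; integ.
congr fine; apply: ae_eq_integral => //.
- apply/measurable_EFinP.
  apply: (measurableT_comp (measurable_eta' th0)).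
  by apply: measurable_funD => //; exact: measurable_funM.
- by apply: measurable_int; integ.
have dom := @normal_prob_dominates R 0 1.
have N1 (c : R) : N [set c] = 0%E.
  have /null_content_dominatesP := dom; apply => //.
  exact: lebesgue_measure_set1.
(* The values of [z] that hit a kink form a null set, which makes the unspecified values of [eta']
   harmless. *)
exists ([set a] `|` [set - b]); split.
- exact: measurableU.
- apply: null_set_setU => //; exact: N1.
move=> z /= H; apply: contrapT => /not_orP [za zb]; apply: H => _.
congr EFin; rewrite eta'E//; last 2 first.
- apply/eqP => h; apply: za; rewrite /a -h.
  by field; rewrite gt_eqF.
- apply/eqP => h; apply: zb; rewrite /b -[th]opprK -h.
  by field; rewrite gt_eqF.
rewrite !indcyE.
have -> : (a <= z) = (th < x + t * z).
  rewrite le_eqVlt; have [h|_] := eqVneq a z; first by case: za.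
  by rewrite /= /a ltr_pdivrMr// ltrBlDl mulrC.
have -> : (- b <= z) = (- th <= x + t * z).
  by rewrite lerNl /b ler_pdivlMr// mulNr [z * t]mulrC; apply/idP/idP; lra.
have [h1|h1] := ltP th (x + t * z).
  rewrite (lt_le_trans h1 (ler_norm _)).
  by rewrite ifT; lra.
have [h2|h2] := leP (- th) (x + t * z).
  by rewrite ifF ?sub0r ?addNr//; apply/negbTE; rewrite -leNgt ler_norml h2.
by rewrite ifT ?subrr ?add0r// ltr0_norm; lra.
Qed.

Lemma stein_eta x t th : 0 < t -> 0 <= th ->
  \int[N]_z (z * eta (x + t * z) th) = t * \int[N]_z eta' (x + t * z) th.
Proof. by move=> t0 th0; rewrite expect_id_eta// expect_eta'. Qed.

(* [alpha_min] is where this risk of [eta] at signal 0 equals [delta] (for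
   [0 <= a], [Num.max (`|z| - a) 0 = `|eta z a|]). *)
Definition risk0 a : R := \int[N]_z (Num.max (`|z| - a) 0) ^+ 2.

Lemma L2_pos_norm a : L2 N (fun z => Num.max (`|z| - a) 0).
Proof. by l2. Qed.

(** By [sqr_eta] the risk is [E[z eta] - a E|eta|], and both terms come from ramps at [a] and
    [- a]. *)
Lemma risk0E a : 0 <= a -> risk0 a = 2 * ((1 + a ^+ 2) * Phi (- a) - a * phi a).
Proof.
move=> a0.
have e z : Num.max (`|z| - a) 0 = Num.max (z - a) 0 + Num.max (z - - a) 0 - (z + a).
  have [h|h] := leP 0 z.
    by rewrite ger0_norm// (@max_l _ _ (z - - a)); lra.
  rewrite ltr0_norm// (@max_r _ _ (z - a)); last lra.
  have [h1|h1] := leP 0 (z - - a).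
    by rewrite max_r; lra.
  by rewrite max_l; lra.
have n z : Num.max (`|z| - a) 0 = `|eta z a| by rewrite norm_eta.
have i1 c : N.-integrable setT (EFin \o (fun z => Num.max (z - c) 0)) by integ.
have i4 : N.-integrable setT (EFin \o (@id R)) by integ.
have E1 : \int[N]_z (Num.max (`|z| - a) 0) = 2 * phi a - 2 * a * gtail a.
  transitivity (\int[N]_z (Num.max (z - a) 0 + Num.max (z - - a) 0 - (z + a))).
    by apply: eq_Rintegral => z _; rewrite e.
  rewrite expectB; [|by integ|by integ].
  rewrite expectD; [|by integ|by integ].
  rewrite expectD; [|by integ|by integ].
  rewrite expect_normal_id expect_cst !expect_pos gtailN phi_sym; ring.
have m : L2 N (fun z => eta z a).
  apply: (L2_le _ _ (L2_id_normal R)).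
    exact: measurable_eta.
  by move=> z; rewrite norm_eta// ge_max normr_ge0 andbT; lra.
have E2 : \int[N]_z (z * eta z a) = 2 * gtail a.
  transitivity (\int[N]_z (z * eta (0 + 1 * z) a)).
    by apply: eq_Rintegral => z _; rewrite add0r mul1r.
  by rewrite expect_id_eta// subr0 addr0 !divr1 gtailN; ring.
rewrite /risk0 Phi_gtail.
transitivity (\int[N]_z (z * eta z a - a * Num.max (`|z| - a) 0)).
  by apply: eq_Rintegral => z _; rewrite n -sqr_eta// real_normK ?num_real.
have i5 := L2_pos_norm a.
rewrite expectB; [|by integ|by integ].
rewrite expectZ; last by integ.
by rewrite E1 E2; ring.
Qed.

Let L2sq a : N.-integrable setT (EFin \o (fun z => Num.max (`|z| - a) 0 ^+ 2)).
Proof. exact: (L2_pos_norm a).2. Qed.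

(** On [z >= b] the two squares differ by at least [(b - a)^2], and this event has positive
    probability. *)
Lemma risk0_lt a b : 0 <= a -> a < b -> risk0 b < risk0 a.
Proof.
move=> a0 ab.
have ib := L2_indcy b.
have : (b - a) ^+ 2 * gtail b <= risk0 a - risk0 b.
  rewrite /gtail -expectZ; last by integ.
  rewrite /risk0 -expectB//.
  apply: le_expect; [by integ|by integ|move=> z].
  rewrite indcyE; case: (leP b z) => h.
    have zn := ler_norm z.
    by rewrite !max_l; [nra|lra|lra].
  rewrite mulr0 subr_ge0 ler_pXn2r//; last 2 first.
  - by rewrite nnegrE le_max lexx orbT.
  - by rewrite nnegrE le_max lexx orbT.
  by rewrite ge_max !le_max lexx !orbT andbT; apply/orP; left; lra.
have : 0 < (b - a) ^+ 2 * gtail b by rewrite mulr_gt0 ?gtail_gt0// exprn_gt0// subr_gt0.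
lra.
Qed.

(** Half the risk is [gtail a] minus [a] times the mean of a positive part; the tail is bounded by
    Chebyshev's inequality. *)
Lemma risk0_le_tail a : 0 < a -> risk0 a <= 2 / a ^+ 2.
Proof.
move=> a0; rewrite risk0E; last exact: ltW.
rewrite Phi_gtail.
have ia := L2_indcy a.
have h1 : 0 <= phi a - a * gtail a.
  by rewrite -expect_pos; apply: expect_ge0 => z; rewrite le_max lexx orbT.
have h2 : gtail a <= (a ^+ 2)^-1.
  rewrite -[leRHS]mulr1 -expect_normal_sqr -expectZ; last by integ.
  apply: le_expect; [by integ|by integ|move=> z].
  rewrite indcyE; case: (leP a z) => h.
    by rewrite mulrC ler_pdivlMr ?exprn_gt0// mul1r; nra.
  by rewrite mulr_ge0 ?invr_ge0 ?sqr_ge0// -expr2 sqr_ge0.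
have := mulr_ge0 (ltW a0) h1.
have -> : (1 + a ^+ 2) * gtail a - a * phi a = gtail a - a * (phi a - a * gtail a) by ring.
set i := (a ^+ 2)^-1 in h2 *; lra.
Qed.

Lemma continuous_risk0 : continuous risk0.
Proof.
move=> a.
have ia c := L2_pos_norm c.
have iid := L2_id_normal R.
pose C := \int[N]_z (2 * Num.max (`|z| - a) 0 + 1).
have C0 : 0 <= C.
  by apply: expect_ge0 => z; rewrite addr_ge0// mulr_ge0// le_max lexx orbT.
have key b : `|a - b| <= 1 -> `|risk0 a - risk0 b| <= C * `|a - b|.
  move=> hab; rewrite /risk0 -expectB//.
  rewrite (le_trans (le_normr_Rintegral _ _))//; first by integ.
  rewrite mulrC -expectZ; last by integ.
  apply: le_expect; [by apply: integrable_normr; integ|by integ|move=> z].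
  rewrite subr_sqr normrM.
  have h1 : `|Num.max (`|z| - a) 0 - Num.max (`|z| - b) 0| <= `|a - b|.
    have := ler_norm (a - b); have := ler_norm (- (a - b)); rewrite normrN ler_norml.
    by case: (leP (`|z| - a) 0); case: (leP (`|z| - b) 0); lra.
  apply: ler_pM => //.
  have -> : Num.max (`|z| - a) 0 + Num.max (`|z| - b) 0 = 2 * Num.max (`|z| - a) 0 - (Num.max (`|z| - a) 0 - Num.max (`|z| - b) 0) by ring.
  apply: (le_trans (ler_normB _ _)); apply: lerD; last exact: le_trans h1 hab.
  by rewrite ger0_norm// mulr_ge0// le_max lexx orbT.
apply/cvgrPdist_lt => e e0; near=> b.
have ab1 : `|a - b| <= 1.
  by near: b; apply: cvgr_dist_le => //; exact: cvg_id.
apply: (le_lt_trans (key _ ab1)).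
apply: (@le_lt_trans _ _ ((C + 1) * `|a - b|)); first by rewrite ler_wpM2r// lerDl.
rewrite mulrC -ltr_pdivlMr ?ltr_wpDl//.
near: b; apply: cvgr_dist_lt; first exact: cvg_id.
by rewrite divr_gt0// ltr_wpDl.
Unshelve. all: by end_near.
Qed.

Lemma alpha_min_ge0 (delta : R) : 0 <= alpha_min delta.
Proof. by rewrite /alpha_min; case: xgetP => // a _ []. Qed.

Lemma risk0_eqE (delta a : R) : 0 <= a ->
  ((1 + a ^+ 2) * Phi (- a) - a * phi a = delta / 2) <-> risk0 a = delta.
Proof. by move=> a0; rewrite risk0E//; split; lra. Qed.

Lemma risk0_alpha_min (delta : R) : 0 < alpha_min delta ->
  risk0 (alpha_min delta) = delta.
Proof.
rewrite /alpha_min; case: xgetP => [a _ [a0 /(risk0_eqE _ a0)]//|_].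
by rewrite ltxx.
Qed.

(** If [alpha_min] solves its equation, this is strict monotonicity of the risk. If there is no
    solution, a risk of at least [delta] at [a] would create one by the intermediate value theorem,
    since the risk tends to 0. *)
Lemma risk0_lt_delta (delta a : R) : 0 < delta -> alpha_min delta < a ->
  risk0 a < delta.
Proof.
move=> d0; rewrite /alpha_min; case: xgetP => [b _ [b0 /(risk0_eqE _ b0) <-]|H a0].
  exact: risk0_lt.
rewrite ltNge; apply/negP => da.
(* Both [c >= 1] and [delta * c > 2] hold, whence [2 / c^2 < delta]. *)
pose c := a + 1 + 2 / delta.
have d2 : 0 < 2 / delta by rewrite divr_gt0.
have ac : a <= c by rewrite /c; lra.
have c0 : 0 < c by rewrite /c; lra.
have hc : risk0 c < delta.
  apply: (le_lt_trans (risk0_le_tail c0)).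
  rewrite ltr_pdivrMr ?exprn_gt0//.
  have : 2 < delta * c.
    have -> : delta * c = delta * (a + 1) + 2 by rewrite /c; field; rewrite gt_eqF.
    by rewrite ltrDr mulr_gt0//; lra.
  have c1 : 1 <= c by rewrite /c; lra.
  have := mulr_ge0 (ltW d0) (ltW c0).
  nra.
have [||b] := @IVT R risk0 a c delta ac.
- exact: continuous_subspaceT continuous_risk0.
- by rewrite ge_min le_max da (ltW hc) orbT.
rewrite in_itv/= => /andP[ab _] hb.
have b0 : 0 <= b by apply: le_trans ab; exact: ltW.
by apply: (H b); split => //; apply/risk0_eqE.
Qed.

Lemma expect_abs_gt0 a : 0 < \int[N]_z Num.max (`|z| - a) 0.
Proof.
have ia c := L2_pos_norm c; have ib := L2_indcy (a + 1).
apply: (lt_le_trans (gtail_gt0 (a + 1))).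
apply: le_expect; [by integ|by integ|move=> z].
rewrite indcyE; case: (leP (a + 1) z) => h; last by rewrite le_max lexx orbT.
by rewrite le_max; have := ler_norm z; lra.
Qed.
End gaussian_eta.

(** * Laws and independence *)

Section transfer.
Context d d' (T : measurableType d) (U : measurableType d') (R : realType).
Variables (P : {measure set T -> \bar R}) (Q : {measure set U -> \bar R}).
Variables (p : T -> U) (mp : measurable_fun setT p).
Hypothesis law : forall A, measurable A -> P (p @^-1` A) = Q A.

Lemma integrable_law (f : U -> R) : measurable_fun setT f ->
  P.-integrable setT (EFin \o (fun w => f (p w))) <->
  Q.-integrable setT (EFin \o f).
Proof.
move=> mf.
have mfp : measurable_fun setT (fun w => f (p w)) by exact: measurableT_comp mp.
have E : (\int[P]_w `|(f (p w))%:E| = \int[Q]_x `|(f x)%:E|)%E.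
  rewrite -(@eq_measure_integral _ _ _ setT Q (pushforward P p)); last by move=> A mA _; exact: law.
  rewrite (@ge0_integral_pushforward _ _ _ _ _ _ mp P setT (fun x => `|(f x)%:E|%E)) //.
  by apply: measurableT_comp => //; exact/measurable_EFinP.
split => /integrableP[_ h]; apply/integrableP; split.
- exact/measurable_EFinP.
- by rewrite /= -E.
- exact/measurable_EFinP.
- by rewrite /= E.
Qed.

Lemma expect_law (f : U -> R) : measurable_fun setT f ->
  P.-integrable setT (EFin \o (fun w => f (p w))) ->
  \int[P]_w f (p w) = \int[Q]_x f x.
Proof.
move=> mf intf; congr fine.
rewrite -(@eq_measure_integral _ _ _ setT Q (pushforward P p)); last by move=> A mA _; exact: law.
rewrite (@integral_pushforward _ _ _ _ _ _ mp P setT (EFin \o f)) //.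
exact/measurable_EFinP.
Qed.
End transfer.

Section independent_pair.
Context d d1 d2 (T : measurableType d) (U : measurableType d1)
  (V : measurableType d2) (R : realType).
Variables (P : probability T R) (m1 : probability U R) (m2 : probability V R).
Variables (X : T -> U) (Y : T -> V).
Hypotheses (mX : measurable_fun setT X) (mY : measurable_fun setT Y).
Hypothesis indep : forall A B, measurable A -> measurable B ->
  P (X @^-1` A `&` Y @^-1` B) = (m1 A * m2 B)%E.

Let pr w := (X w, Y w).

Let mpr : measurable_fun setT pr.
Proof. exact: measurable_fun_pair. Qed.

Let pair_law (A : set (U * V)) : measurable A -> P (pr @^-1` A) = (m1 \x m2)%E A.
Proof.
move=> mA.
rewrite (@product_measure_unique _ _ _ _ _ m1 m2 (pushforward P pr)) //.
Qed.

(** Independence gives the pair the product law, and Fubini reduces the claim to a frozen first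
    variable. Both uses, Stein's identity and E[X0 Z] = 0, are of this zero-mean form. *)
Lemma expect_pair_eq0 (f : U * V -> R) : measurable_fun setT f ->
  P.-integrable setT (EFin \o (fun w => f (X w, Y w))) ->
  (forall x, m2.-integrable setT (EFin \o (fun z => f (x, z)))) ->
  (forall x, \int[m2]_z f (x, z) = 0) ->
  \int[P]_w f (X w, Y w) = 0.
Proof.
move=> mf intf iN f0.
rewrite (expect_law mpr pair_law)//.
have /(integrable_law mpr pair_law mf) iQ := intf.
rewrite /Rintegral -(integral12_prod_meas1 iQ).
rewrite integral0_eq// => x _.
have H : (\int[m2]_z (f (x, z))%:E)%E \is a fin_num.
  by have := integrable_fin_num measurableT (iN x).
by rewrite -[LHS](fineK H); congr EFin; exact: f0.
Qed.
End independent_pair.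

Section stein.
Context (R : realType) (pX0 : probability R R) d (Omega : measurableType d)
  (P : probability Omega R).
Variables (X0 Z : {RV P >-> R}).
Hypothesis X0_law : forall A : set R, measurable A -> distribution P X0 A = pX0 A.
Hypothesis Z_law : forall A : set R, measurable A ->
  distribution P Z A = normal_prob 0 1 A.
Hypothesis indep : independent_RV X0 Z.
Local Notation N := (normal_prob (0 : R) 1).

Lemma L2_Z : L2 P Z.
Proof.
split => //.
have H := @integrable_law _ _ _ _ R P N Z (measurable_funPT Z) Z_law (fun z => z ^+ 2).
apply H => //; exact: integrable_sqr_normal.
Qed.

Lemma stein (t th : R) : 0 < t -> 0 <= th -> L2 P X0 ->
  \int[P]_w (Z w * eta (X0 w + t * Z w) th) =
  t * \int[P]_w eta' (X0 w + t * Z w) th.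
Proof.
move=> t0 th0 hX; have hZ := L2_Z.
have mu1 : measurable_fun setT (fun w => X0 w + t * Z w).
  by apply: measurable_funD => //; exact: measurable_funM.
have [C hC] := eta'_bounded th0.
have he : L2 P (fun w => eta (X0 w + t * Z w) th).
  apply: (@L2_le _ _ _ _ _ (fun w => X0 w + t * Z w)); last by l2.
    exact: measurable_eta.
  by move=> w; rewrite norm_eta// ge_max normr_ge0 andbT; lra.
have he' : L2 P (fun w => eta' (X0 w + t * Z w) th).
  apply: (@L2_bounded _ _ _ _ C) => //.
  exact: measurableT_comp (measurable_eta' th0) mu1.
have i1 : P.-integrable setT (EFin \o (fun w => Z w * eta (X0 w + t * Z w) th)) by integ.
have i2 : P.-integrable setT (EFin \o (fun w => eta' (X0 w + t * Z w) th)) by integ.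
apply/eqP; rewrite -expectZ// -subr_eq0 -expectB//; last by integ.
pose f (u : R * R) := u.2 * eta (u.1 + t * u.2) th - t * eta' (u.1 + t * u.2) th.
have mu2 : measurable_fun setT (fun u : R * R => u.1 + t * u.2).
  by apply: measurable_funD => //; exact: measurable_funM.
have iN x : N.-integrable setT (EFin \o (fun z => z * eta (x + t * z) th)) /\
    N.-integrable setT (EFin \o (fun z => eta' (x + t * z) th)).
  have iid := @L2_id_normal R.
  have me : measurable_fun setT (fun z => x + t * z).
    by apply: measurable_funD => //; exact: measurable_funM.
  split.
    apply: L2M => //; apply: (@L2_le _ _ R N (fun z => eta (x + t * z) th) (fun z => x + t * z)). 3: by l2.
      exact: measurable_eta.
    by move=> w; rewrite norm_eta// ge_max normr_ge0 andbT; lra.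
  apply: L2_integrable; apply: (@L2_bounded _ _ _ _ C) => //.
  exact: measurableT_comp (measurable_eta' th0) me.
apply/eqP; apply: (@expect_pair_eq0 _ _ _ _ _ _ _ P pX0 N X0 Z (measurable_funPT X0) (measurable_funPT Z) _ f).
- move=> A B mA mB; rewrite indep//; congr (_ * _)%E; [exact: X0_law|exact: Z_law].
- apply: measurable_funB; apply: measurable_funM => //.
    exact: measurable_eta.
  exact: measurableT_comp (measurable_eta' th0) mu2.
- by integ.
- move=> x; have [i3 i4] := iN x; by integ.
- move=> x; have [i3 i4] := iN x.
  rewrite expectB; [|by integ|by integ].
  by rewrite expectZ// stein_eta// subrr.
Qed.
End stein.

(** * The calibration map *)

Section calibration.
Context (R : realType) d (T : measurableType d) (P : probability T R).
Variables (X Z : T -> R) (delta s2 : R).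
Hypotheses (hX : L2 P X) (hZ : L2 P Z) (delta0 : 0 < delta) (s20 : 0 < s2).
Implicit Types t th a : R.

(** At a fixed point [t] with [th = a * t] this is the minimizer [W] of the overview; [mabs] is then
    [V(W)]. *)
Definition resid t th w := eta (X w + t * Z w) th - X w.
Definition msq t th : R := \int[P]_w resid t th w ^+ 2.
Definition corr t th : R := \int[P]_w (Z w * eta (X w + t * Z w) th).
Definition mabs t th : R := \int[P]_w `|eta (X w + t * Z w) th|.
(* By Stein's identity [corr t th = t E eta'(X + t Z; th)]. *)
Definition beta t th : R := t - corr t th / delta.
(** [tau_star] asks for [0 <= t]; as [s2 > 0] no solution is 0, and the strict form serves the
    divisions by [t]. *)
Definition fixed_point a t := 0 < t /\ t ^+ 2 = s2 + msq t (a * t) / delta.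

Lemma L2_arg t : L2 P (fun w => X w + t * Z w).
Proof. by l2. Qed.

Lemma L2_eta t th : 0 <= th -> L2 P (fun w => eta (X w + t * Z w) th).
Proof.
move=> th0; have h := L2_arg t; apply: (L2_le _ _ h).
  by apply: measurable_eta => //; exact: L2_measurable h.
by move=> w; rewrite norm_eta// ge_max normr_ge0 andbT; lra.
Qed.

Lemma L2_resid t th : 0 <= th -> L2 P (resid t th).
Proof. by move=> th0; apply: L2B => //; exact: L2_eta. Qed.

Lemma msq_ge0 t th : 0 <= msq t th.
Proof. by apply: expect_ge0 => w; exact: sqr_ge0. Qed.

Lemma integrable_sqr f : L2 P f -> P.-integrable setT (EFin \o (fun w => f w ^+ 2)).
Proof. by case. Qed.

(* First-order optimality of [resid t1 (a1 * t1)]: the gradient of the convex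
   functional against the direction [resid t2 th2 - resid t1 (a1 * t1)]. *)
Lemma expect_prox t1 a1 t2 th2 : 0 < t1 -> 0 <= a1 -> 0 <= th2 ->
  0 <= (\int[P]_w (resid t1 (a1 * t1) w * resid t2 th2 w) - msq t1 (a1 * t1)) / t1
       - corr t2 th2 + corr t1 (a1 * t1) + a1 * (mabs t2 th2 - mabs t1 (a1 * t1)).
Proof.
move=> t10 a10 th20; set th1 := a1 * t1.
have th10 : 0 <= th1 by rewrite mulr_ge0// ltW.
have e1 := L2_eta t1 th10; have e2 := L2_eta t2 th20.
have r1 := L2_resid t1 th10; have r2 := L2_resid t2 th20.
have r1s := integrable_sqr r1.
have h : 0 <= \int[P]_w (t1^-1 * (resid t1 th1 w * resid t2 th2 w - resid t1 th1 w ^+ 2)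
    - Z w * eta (X w + t2 * Z w) th2 + Z w * eta (X w + t1 * Z w) th1
    + a1 * (`|eta (X w + t2 * Z w) th2| - `|eta (X w + t1 * Z w) th1|)).
  apply: expect_ge0 => w.
  have := eta_prox (X w + t1 * Z w) (eta (X w + t2 * Z w) th2) th10.
  rewrite /resid /th1; set E1 := eta (X w + t1 * Z w) _; set E2 := eta _ th2.
  move=> hp; have ti : 0 <= t1^-1 by rewrite invr_ge0 ltW.
  have := mulr_ge0 ti hp.
  congr (0 <= _); rewrite /=; field; rewrite gt_eqF//.
rewrite expectD in h; [|by integ|by integ].
rewrite expectD in h; [|by integ|by integ].
rewrite expectB in h; [|by integ|by integ].
rewrite expectZ in h; last by integ.
rewrite expectB in h; [|by integ|by integ].
rewrite expectZ in h; last by integ.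
rewrite expectB in h; [|by integ|by integ].
by rewrite [_ / t1]mulrC.
Qed.

(** The tangent inequality for [w |-> sqrt(s2 + E w^2 / delta)], keeping the strict convexity as a
    quadratic term. It is [E (t2 W1 - t1 W2)^2 >= 0] with each [E Wi^2] replaced by
    [delta (ti^2 - s2)]. *)
Lemma inner_resid_le t1 a1 t2 a2 : 0 <= a1 -> 0 <= a2 ->
  fixed_point a1 t1 -> fixed_point a2 t2 ->
  (\int[P]_w (resid t1 (a1 * t1) w * resid t2 (a2 * t2) w) - msq t1 (a1 * t1)) / t1
   <= delta * (t2 - t1) - delta * s2 * (t1 - t2) ^+ 2 / (2 * t1 ^+ 2 * t2).
Proof.
move=> a10 a20 [t10 e1] [t20 e2].
have th10 : 0 <= a1 * t1 by rewrite mulr_ge0// ltW.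
have th20 : 0 <= a2 * t2 by rewrite mulr_ge0// ltW.
have r1 := L2_resid t1 th10; have r2 := L2_resid t2 th20.
have r1s := integrable_sqr r1; have r2s := integrable_sqr r2.
set I := \int[P]_w _.
have m1 : msq t1 (a1 * t1) = delta * (t1 ^+ 2 - s2) by rewrite e1; field; rewrite gt_eqF.
have m2 : msq t2 (a2 * t2) = delta * (t2 ^+ 2 - s2) by rewrite e2; field; rewrite gt_eqF.
have : 0 <= t2 ^+ 2 * msq t1 (a1 * t1) + t1 ^+ 2 * msq t2 (a2 * t2) - 2 * t1 * t2 * I.
  rewrite /msq /I -!expectZ; [|by integ|by integ|by integ].
  rewrite -expectD; [|by integ|by integ].
  rewrite -expectB; [|by integ|by integ].
  apply: expect_ge0 => w.
  have := sqr_ge0 (t2 * resid t1 (a1 * t1) w - t1 * resid t2 (a2 * t2) w).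
  by congr (0 <= _); ring.
rewrite m1 m2 => h.
rewrite -subr_ge0.
have -> : delta * (t2 - t1) - delta * s2 * (t1 - t2) ^+ 2 / (2 * t1 ^+ 2 * t2) -
    (I - delta * (t1 ^+ 2 - s2)) / t1 =
  (t2 ^+ 2 * (delta * (t1 ^+ 2 - s2)) + t1 ^+ 2 * (delta * (t2 ^+ 2 - s2)) - 2 * t1 * t2 * I)
   / (2 * t1 ^+ 2 * t2).
  by field; rewrite !gt_eqF.
by rewrite divr_ge0// !mulr_ge0// ?sqr_ge0// ltW.
Qed.

(** The functional with penalty [a1] exceeds its minimum at the second minimizer by at least the
    convexity gap. *)
Lemma compare_fixed_points t1 a1 t2 a2 : 0 <= a1 -> 0 <= a2 ->
  fixed_point a1 t1 -> fixed_point a2 t2 ->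
  delta * s2 * (t1 - t2) ^+ 2 / (2 * t1 ^+ 2 * t2) <=
  delta * (beta t2 (a2 * t2) - beta t1 (a1 * t1)) +
    a1 * (mabs t2 (a2 * t2) - mabs t1 (a1 * t1)).
Proof.
move=> a10 a20 f1 f2.
have h1 := inner_resid_le a10 a20 f1 f2.
have [t10 _] := f1; have [t20 _] := f2.
have th20 : 0 <= a2 * t2 by rewrite mulr_ge0// ltW.
have h2 := expect_prox t2 t10 a10 th20.
have -> : delta * (beta t2 (a2 * t2) - beta t1 (a1 * t1)) =
  delta * (t2 - t1) - corr t2 (a2 * t2) + corr t1 (a1 * t1).
  by rewrite /beta; field; rewrite gt_eqF.
lra.
Qed.

Let gap_ge0 t1 t2 : 0 < t1 -> 0 < t2 ->
  0 <= delta * s2 * (t1 - t2) ^+ 2 / (2 * t1 ^+ 2 * t2).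
Proof.
move=> t10 t20; apply: divr_ge0.
  by apply: mulr_ge0; [exact/ltW/mulr_gt0|exact: sqr_ge0].
by apply/ltW/mulr_gt0 => //; apply: mulr_gt0 => //; exact: exprn_gt0.
Qed.

(** With equal penalties the two comparisons have opposite right-hand sides, so the gaps must
    vanish. *)
Lemma fixed_point_unique a t1 t2 : 0 <= a ->
  fixed_point a t1 -> fixed_point a t2 -> t1 = t2.
Proof.
move=> a0 f1 f2.
have h1 := compare_fixed_points a0 a0 f1 f2.
have h2 := compare_fixed_points a0 a0 f2 f1.
have [t10 _] := f1; have [t20 _] := f2.
apply/eqP; rewrite -subr_eq0; apply: contraT => ne.
have p1 : 0 < delta * s2 * (t1 - t2) ^+ 2 / (2 * t1 ^+ 2 * t2).
  have sq : 0 < (t1 - t2) ^+ 2 by rewrite exprn_even_gt0.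
  apply: divr_gt0; first by apply: mulr_gt0 => //; exact: mulr_gt0.
  by apply: mulr_gt0 => //; apply: mulr_gt0 => //; exact: exprn_gt0.
have p2 : 0 <= delta * s2 * (t2 - t1) ^+ 2 / (2 * t2 ^+ 2 * t1).
  exact: gap_ge0.
lra.
Qed.

(** Adding the two comparisons cancels [beta] and shows that [mabs] does not increase. The
    comparison with penalty [a1] then bounds [delta] times the increase of [beta] below by [a1]
    times the decrease of [mabs]. *)
Lemma beta_nondecreasing t1 a1 t2 a2 : 0 <= a1 -> a1 <= a2 ->
  fixed_point a1 t1 -> fixed_point a2 t2 ->
  beta t1 (a1 * t1) <= beta t2 (a2 * t2).
Proof.
move=> a10; rewrite le_eqVlt => /predU1P[<-|a12] f1 f2.
  by rewrite (fixed_point_unique a10 f1 f2).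
have a20 : 0 <= a2 by apply: le_trans (ltW a12).
have h1 := compare_fixed_points a10 a20 f1 f2.
have h2 := compare_fixed_points a20 a10 f2 f1.
have [t10 _] := f1; have [t20 _] := f2.
have p1 : 0 <= delta * s2 * (t1 - t2) ^+ 2 / (2 * t1 ^+ 2 * t2).
  exact: gap_ge0.
have p2 : 0 <= delta * s2 * (t2 - t1) ^+ 2 / (2 * t2 ^+ 2 * t1).
  exact: gap_ge0.
have hV : 0 <= mabs t1 (a1 * t1) - mabs t2 (a2 * t2).
  rewrite -(@pmulr_rge0 _ (a2 - a1)) ?subr_gt0//; lra.
have := mulr_ge0 a10 hV => h3.
rewrite -subr_ge0 -(@pmulr_rge0 _ delta)//; lra.
Qed.

Lemma resid_lipschitz t th t' th' w : 0 <= th -> 0 <= th' ->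
  `|resid t th w - resid t' th' w| <= (`|t - t'| + `|th - th'|) * (`|Z w| + 1).
Proof.
move=> h h'; rewrite /resid opprB addrA subrK.
apply: (le_trans (eta_lipschitz _ _ h h')).
rewrite (_ : X w + t * Z w - (X w + t' * Z w) = (t - t') * Z w); last by ring.
rewrite normrM.
have := mulr_ge0 (normr_ge0 (th - th')) (normr_ge0 (Z w)).
have := normr_ge0 (t - t'); lra.
Qed.

Lemma msq_corr_lipschitz t th : 0 <= th -> exists2 C, 0 <= C &
  forall t' th', 0 <= th' -> `|t - t'| + `|th - th'| <= 1 ->
    `|msq t th - msq t' th'| <= C * (`|t - t'| + `|th - th'|) /\
    `|corr t th - corr t' th'| <= C * (`|t - t'| + `|th - th'|).
Proof.
move=> th0; have rt := L2_resid t th0; have et := L2_eta t th0.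
(* In [r^2 - r'^2] the factor [r + r'] is written [2 r - (r - r')]; for displacements at most 1 the
   majorant then depends on the base point alone. *)
pose g w := (`|Z w| + 1) * (2 * `|resid t th w| + (`|Z w| + 1)).
pose k w := `|Z w| * (`|Z w| + 1).
have ig : P.-integrable setT (EFin \o g) by rewrite /g; integ.
have ik : P.-integrable setT (EFin \o k) by rewrite /k; integ.
have g0 : 0 <= \int[P]_w g w.
  by apply: expect_ge0 => w; rewrite /g mulr_ge0 ?addr_ge0// mulr_ge0.
have k0 : 0 <= \int[P]_w k w.
  by apply: expect_ge0 => w; rewrite /k mulr_ge0 ?addr_ge0.
exists (\int[P]_w g w + \int[P]_w k w); first by rewrite addr_ge0.
move=> t' th' th'0; set r := _ + _ => r1.
have r0 : 0 <= r by rewrite addr_ge0.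
have rt' := L2_resid t' th'0; have et' := L2_eta t' th'0.
have rts := integrable_sqr rt; have rts' := integrable_sqr rt'.
have lip w := resid_lipschitz t t' w th0 th'0.
split.
- apply: (@le_trans _ _ ((\int[P]_w g w) * r)); last by rewrite ler_wpM2r// lerDl.
  rewrite /msq -expectB//.
  rewrite (le_trans (le_normr_Rintegral _ _))//; first by integ.
  rewrite mulrC -expectZ//.
  apply: le_expect; [by apply: integrable_normr; integ|by integ|move=> w].
  rewrite subr_sqr normrM /g mulrA.
  apply: ler_pM => //.
  have -> : resid t th w + resid t' th' w =
     2 * resid t th w - (resid t th w - resid t' th' w) by ring.
  apply: (le_trans (ler_normB _ _)); rewrite normrM ger0_norm// lerD2l.
  apply: (le_trans (lip w)); rewrite -/r.
  by rewrite ler_piMl// addr_ge0.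
- apply: (@le_trans _ _ ((\int[P]_w k w) * r)); last by rewrite ler_wpM2r// lerDr.
  rewrite /corr -expectB; [|by integ|by integ].
  rewrite (le_trans (le_normr_Rintegral _ _))//; first by integ.
  rewrite mulrC -expectZ//.
  apply: le_expect; [by apply: integrable_normr; integ|by integ|move=> w].
  rewrite -mulrBr normrM /k mulrCA ler_wpM2l//.
  apply: le_trans (lip w); rewrite /resid.
  by rewrite opprB addrA subrK.
Qed.

Lemma cvg_msq_corr (u v : R -> R) a : u x @[x --> a] --> u a ->
  v x @[x --> a] --> v a -> (\forall x \near a, 0 <= v x) -> 0 <= v a ->
  msq (u x) (v x) @[x --> a] --> msq (u a) (v a) /\
  corr (u x) (v x) @[x --> a] --> corr (u a) (v a).
Proof.
move=> cu cv v0 va0.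
have [C C0 hC] := msq_corr_lipschitz (u a) va0.
have key e : 0 < e -> \forall x \near a, 0 <= v x /\ `|u a - u x| + `|v a - v x| <= 1 /\
    C * (`|u a - u x| + `|v a - v x|) <= e.
  move=> e0.
  pose e' := Num.min 1 (e / (C + 1)) / 2.
  have C1 : 0 < C + 1 by lra.
  have m0 : 0 < Num.min 1 (e / (C + 1)) by rewrite lt_min ltr01 divr_gt0.
  have e'0 : 0 < e' by rewrite divr_gt0.
  near=> x.
  have h1 : `|u a - u x| <= e' by near: x; exact: (cvgr_dist_le _ _ cu _ e'0).
  have h2 : `|v a - v x| <= e' by near: x; exact: (cvgr_dist_le _ _ cv _ e'0).
  have h3 : `|u a - u x| + `|v a - v x| <= Num.min 1 (e / (C + 1)).
    by move: h1 h2; rewrite /e'; lra.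
  have h4 : Num.min 1 (e / (C + 1)) <= 1 by rewrite ge_min lexx.
  have h5 : Num.min 1 (e / (C + 1)) <= e / (C + 1) by rewrite ge_min lexx orbT.
  split; first by near: x.
  split; first exact: le_trans h4.
  apply: (@le_trans _ _ ((C + 1) * (e / (C + 1)))).
    apply: ler_pM; [by []|exact: addr_ge0|by rewrite lerDl|exact: le_trans h5].
  by rewrite mulrC divfK// gt_eqF.
split; apply/cvgrPdist_le => e /key; apply: filterS => x [vx [r1 re]].
- by apply: le_trans re; have [] := hC _ _ vx r1.
- by apply: le_trans re; have [] := hC _ _ vx r1.
Unshelve. all: by end_near.
Qed.

(** * Existence and continuity of the fixed point *)

Hypothesis Z_risk0 : forall a : R, 0 <= a ->
  \int[P]_w Num.max (`|Z w| - a) 0 ^+ 2 = risk0 a.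
Hypothesis Z_abs_gt0 : forall a : R, 0 < \int[P]_w Num.max (`|Z w| - a) 0.
Hypothesis XZ_uncorrelated : \int[P]_w (X w * Z w) = 0.
Local Notation amin := (alpha_min delta).

(* Absolute values make [gap a] continuous on the whole line: [eta] is a proximal
   map only for thresholds [>= 0]. *)
Let gap a t := s2 + msq `|t| (a * `|t|) / delta - t ^+ 2.

(** At signal 0 thresholding scales with [t], and adding the signal costs at most [2 |X|]. Young's
    inequality with weight [e] keeps the leading coefficient as close to [risk0 a] as desired. *)
Lemma msq_scale_le a t (e : R) : 0 <= a -> 0 <= t -> 0 < e ->
  msq t (a * t) <= (1 + e) * risk0 a * t ^+ 2 +
     (1 + e^-1) * 4 * \int[P]_w X w ^+ 2.
Proof.
move=> a0 t0 e0.
have th0 : 0 <= a * t by rewrite mulr_ge0.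
have rt := integrable_sqr (L2_resid t th0).
have hm : L2 P (fun w => Num.max (`|Z w| - a) 0) by l2.
have im := integrable_sqr hm; have iX := integrable_sqr hX.
rewrite -Z_risk0// [X in _ <= X + _]mulrAC /msq -!expectZ; [|by []|by []].
rewrite -expectD; [|by integ|by integ].
apply: le_expect; [by []|by integ|move=> w].
set m := Num.max _ _.
have h : `|resid t (a * t) w| <= t * m + 2 * `|X w|.
  rewrite /resid.
  have -> : eta (X w + t * Z w) (a * t) - X w = eta (t * Z w) (a * t) +
    (eta (X w + t * Z w) (a * t) - eta (t * Z w) (a * t)) - X w by ring.
  apply: (le_trans (ler_normB _ _)).
  have h1 := ler_normD (eta (t * Z w) (a * t)) (eta (X w + t * Z w) (a * t) - eta (t * Z w) (a * t)).
  have h2 := eta_lipschitz (X w + t * Z w) (t * Z w) th0 th0.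
  rewrite addrK subrr normr0 addr0 in h2.
  have h3 : `|eta (t * Z w) (a * t)| = t * m.
    by rewrite [a * t]mulrC eta_scale// normrM norm_eta// (ger0_norm t0).
  lra.
have m0 : 0 <= m by rewrite le_max lexx orbT.
have x0 := normr_ge0 (X w).
rewrite -[resid _ _ w ^+ 2]real_normK ?num_real// -[X w ^+ 2]real_normK ?num_real//.
apply: (@le_trans _ _ ((t * m + 2 * `|X w|) ^+ 2)).
  by rewrite ler_pXn2r ?nnegrE ?addr_ge0 ?mulr_ge0.
have sq := sqr_ge0 (e * (t * m) - 2 * `|X w|).
rewrite -subr_ge0.
have -> : (1 + e) * t ^+ 2 * m ^+ 2 + (1 + e^-1) * 4 * `|X w| ^+ 2 - (t * m + 2 * `|X w|) ^+ 2
   = (e * (t * m) - 2 * `|X w|) ^+ 2 / e by field; rewrite gt_eqF.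
by rewrite divr_ge0// ltW.
Qed.

(** Thresholding moves its argument by at most [a * t], so [|resid| >= t (|Z| - a)] whatever the
    signal. *)
Lemma msq_ge_risk0 a t : 0 <= a -> 0 <= t -> t ^+ 2 * risk0 a <= msq t (a * t).
Proof.
move=> a0 t0; have th0 : 0 <= a * t by rewrite mulr_ge0.
have rt := integrable_sqr (L2_resid t th0).
have hm : L2 P (fun w => Num.max (`|Z w| - a) 0) by l2.
have im := integrable_sqr hm.
rewrite -Z_risk0// -expectZ//; apply: le_expect; [by integ|by []|move=> w].
rewrite -exprMn -[leRHS]real_normK ?num_real//.
rewrite ler_pXn2r ?nnegrE ?mulr_ge0 ?le_max ?lexx ?orbT//.
have -> : resid t (a * t) w = t * Z w + (eta (X w + t * Z w) (a * t) - (X w + t * Z w)).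
  by rewrite /resid; ring.
have := eta_sub_norm (X w + t * Z w) th0.
set v := eta _ _ - _ => hv.
have h : `|t * Z w| <= `|t * Z w + v| + `|v|.
  by rewrite -[t * Z w](addrK v) (le_trans (ler_normB _ _))// addrK.
rewrite normrM ger0_norm// in h.
have := normr_ge0 (t * Z w + v).
case: (leP (`|Z w| - a) 0) => _; first by rewrite mulr0.
lra.
Qed.

Let continuous_gap a : 0 <= a -> continuous (gap a).
Proof.
move=> a0 t; rewrite /gap.
have cn : `|x| @[x --> t] --> `|t| by apply: cvg_norm; exact: cvg_id.
have cv : a * `|x| @[x --> t] --> a * `|t| by apply: cvgM => //; exact: cvg_cst.
have pos : \forall x \near t, 0 <= a * `|x| by near=> x; rewrite mulr_ge0.
have [h _] := cvg_msq_corr cn cv pos (mulr_ge0 a0 (normr_ge0 t)).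
apply: cvgB; last exact: exprn_continuous.
apply: cvgD; first exact: cvg_cst.
by apply: cvgM => //; exact: cvg_cst.
Unshelve. all: by end_near.
Qed.

Let gap_cvg a0 t : 0 < a0 -> gap a t @[a --> a0] --> gap a0 t.
Proof.
move=> a00; rewrite /gap.
have cn : (cst `|t|) x @[x --> a0] --> (cst `|t|) a0 by exact: cvg_cst.
have cv : x * `|t| @[x --> a0] --> a0 * `|t|.
  by apply: cvgM; [exact: cvg_id|exact: cvg_cst].
have pos : \forall x \near a0, 0 <= x * `|t|.
  near=> x; apply: mulr_ge0 => //; apply/ltW; near: x; exact: lt_nbhsr.
have [h _] := cvg_msq_corr cn cv pos (mulr_ge0 (ltW a00) (normr_ge0 t)).
apply: cvgB; last exact: cvg_cst.
apply: cvgD; first exact: cvg_cst.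
by apply: cvgM => //; exact: cvg_cst.
Unshelve. all: by end_near.
Qed.

Let gap_eq0 a t : 0 <= t -> gap a t = 0 -> fixed_point a t.
Proof.
move=> t0; rewrite /gap ger0_norm// => h.
have e : t ^+ 2 = s2 + msq t (a * t) / delta by lra.
split=> //; rewrite lt_neqAle t0 andbT; apply/eqP => t00.
have m0 : 0 <= msq t (a * t) / delta by rewrite divr_ge0 ?msq_ge0// ltW.
have : 0 < t ^+ 2 by rewrite e ltr_pwDl.
by rewrite -t00 expr0n ltxx.
Qed.

Let gap0 a : 0 < gap a 0.
Proof.
rewrite /gap expr0n subr0 ltr_pwDl// divr_ge0 ?msq_ge0//.
exact: ltW.
Qed.

Let alpha_gt0 a : amin < a -> 0 < a.
Proof. exact: le_lt_trans (alpha_min_ge0 _). Qed.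

Let gap_neg a M : amin < a -> exists2 t, M <= t & 0 <= t /\ gap a t < 0.
Proof.
move=> ha; have a0 := alpha_gt0 ha; have hr := risk0_lt_delta delta0 ha.
set r := risk0 a in hr.
have r0 : 0 <= r by apply: expect_ge0 => z; exact: sqr_ge0.
(* Chosen so that [(1 + e) * r] is at most the midpoint of [r] and [delta]. *)
pose e := (delta - r) / (2 * delta).
have e0 : 0 < e by rewrite divr_gt0 ?mulr_gt0// subr_gt0.
set K := (1 + e^-1) * 4 * \int[P]_w X w ^+ 2.
have K0 : 0 <= K.
  rewrite mulr_ge0 ?mulr_ge0 ?addr_ge0 ?invr_ge0 ?(ltW e0)//.
  by apply: expect_ge0 => w; exact: sqr_ge0.
have er : (1 + e) * r <= (delta + r) / 2.
  have h : e * r <= (delta - r) / 2.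
    have -> : (delta - r) / 2 = e * delta by rewrite /e; field; rewrite gt_eqF.
    by apply: ler_wpM2l; exact: ltW.
  lra.
(* Once [t > B] and [t >= 1], [(delta - r) / 2 * t^2] outweighs the constants [s2 * delta + K]. *)
pose B := (s2 * delta + K) / ((delta - r) / 2).
have dr : 0 < (delta - r) / 2 by lra.
have B0 : 0 <= B by apply: divr_ge0; [apply: addr_ge0 => //; exact/ltW/mulr_gt0|exact: ltW].
pose t := `|M| + B + 1.
have t1 : 1 <= t by rewrite /t; have := normr_ge0 M; lra.
exists t; first by rewrite /t; have := ler_norm M; lra.
have t0 : 0 <= t by lra.
split=> //; rewrite /gap ger0_norm//.
have h := msq_scale_le (ltW a0) t0 e0.
rewrite -/r -/K in h.
have h2 : (1 + e) * r * t ^+ 2 <= (delta + r) / 2 * t ^+ 2 by rewrite ler_wpM2r ?sqr_ge0.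
have h3 : s2 * delta + K < (delta - r) / 2 * t ^+ 2.
  rewrite -ltr_pdivrMl// [_^-1 * _]mulrC -/B.
  apply: (@lt_le_trans _ _ t); first by rewrite /t; have := normr_ge0 M; lra.
  by rewrite expr2 ler_peMr.
have -> : s2 + msq t (a * t) / delta - t ^+ 2 = (s2 * delta + msq t (a * t) - delta * t ^+ 2) / delta.
  by field; rewrite gt_eqF.
rewrite pmulr_llt0 ?invr_gt0//; lra.
Qed.

Lemma fixed_point_exists a : amin < a -> exists t, fixed_point a t.
Proof.
move=> ha; have a0 := alpha_gt0 ha.
have [t _ [t0 ht]] := gap_neg 0 ha.
have [||x] := @IVT R (gap a) 0 t 0 t0.
- exact/continuous_subspaceT/continuous_gap/ltW.
- by rewrite ge_min le_max (ltW ht) (ltW (gap0 a)) orbT.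
by rewrite in_itv/= => /andP[x0 _] /(gap_eq0 x0); exists x.
Qed.

Definition tau a : R := xget 0 [set t | fixed_point a t].

Lemma tauP a : amin < a -> fixed_point a (tau a).
Proof.
move=> /fixed_point_exists [t ht]; rewrite /tau.
exact: (@xgetPex _ 0 [set t | fixed_point a t]) (ex_intro _ t ht).
Qed.

Lemma tau_unique a t : amin < a -> fixed_point a t -> tau a = t.
Proof.
move=> ha ft.
exact: (fixed_point_unique (ltW (alpha_gt0 ha)) (tauP ha) ft).
Qed.

(** By uniqueness [gap a0] is positive just left of [tau a0] and negative just right of it. At two
    fixed points these signs persist for nearby [a], and the intermediate value theorem traps
    [tau a] in between. *)
Lemma cvg_tau a0 : amin < a0 -> tau a @[a --> a0] --> tau a0.
Proof.
move=> ha0; have a00 := alpha_gt0 ha0.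
have f0 := tauP ha0; have [t00 _] := f0.
apply/cvgrPdist_le => e0 e00.
pose e := Num.min e0 (tau a0 / 2).
have e_gt0 : 0 < e by rewrite lt_min e00 divr_gt0.
have ee0 : e <= e0 by rewrite ge_min lexx.
have et : e <= tau a0 / 2 by rewrite ge_min lexx orbT.
have lo : 0 < gap a0 (tau a0 - e).
  rewrite ltNge; apply/negP => hle.
  have le0 : 0 <= tau a0 - e by lra.
  have [||x] := @IVT R (gap a0) 0 (tau a0 - e) 0 le0.
  - exact/continuous_subspaceT/continuous_gap/ltW.
  - by rewrite ge_min le_max hle (ltW (gap0 a0)) orbT.
  rewrite in_itv/= => /andP[x0 xt] /(gap_eq0 x0) /(tau_unique ha0) tx.
  suff : (0 : R) < 0 by rewrite ltxx.
  lra.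
have hi : gap a0 (tau a0 + e) < 0.
  rewrite ltNge; apply/negP => hle.
  have [t tt [t0 ht]] := gap_neg (tau a0 + e) ha0.
  have [||x] := @IVT R (gap a0) (tau a0 + e) t 0 tt.
  - exact/continuous_subspaceT/continuous_gap/ltW.
  - by rewrite ge_min le_max (ltW ht) hle orbT.
  rewrite in_itv/= => /andP[x1 xt]; have x0 : 0 <= x by lra.
  move=> /(gap_eq0 x0) /(tau_unique ha0) tx.
  suff : (0 : R) < 0 by rewrite ltxx.
  lra.
have c1 := @gap_cvg a0 (tau a0 - e) a00.
have c2 := @gap_cvg a0 (tau a0 + e) a00.
near=> a.
have ha : amin < a by near: a; exact: lt_nbhsr.
have lo' : 0 < gap a (tau a0 - e) by near: a; exact: (cvgr_gt _ c1).
have hi' : gap a (tau a0 + e) < 0 by near: a; exact: (cvgr_lt _ c2).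
have le2 : tau a0 - e <= tau a0 + e by lra.
have [||x] := @IVT R (gap a) (tau a0 - e) (tau a0 + e) 0 le2.
- exact/continuous_subspaceT/continuous_gap/ltW/alpha_gt0.
- by rewrite ge_min le_max (ltW hi') (ltW lo') orbT.
rewrite in_itv/= => /andP[x1 x2]; have x0 : 0 <= x by lra.
move=> /(gap_eq0 x0) /(tau_unique ha) ->.
by rewrite ler_norml; lra.
Unshelve. all: by end_near.
Qed.

(* [lambda(a) / a]. *)
Definition slope a := beta (tau a) (a * tau a).

Lemma slope_nondecreasing a b : amin < a -> a <= b -> slope a <= slope b.
Proof.
move=> ha ab; have hb := lt_le_trans ha ab.
by apply: (beta_nondecreasing (ltW (alpha_gt0 ha)) ab); exact: tauP.
Qed.

Lemma cvg_slope a0 : amin < a0 -> slope a @[a --> a0] --> slope a0.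
Proof.
move=> ha0; have a00 := alpha_gt0 ha0.
have ct := cvg_tau ha0.
have cv : x * tau x @[x --> a0] --> a0 * tau a0 by apply: cvgM => //; exact: cvg_id.
have [t0 _] := tauP ha0.
have pos : \forall x \near a0, 0 <= x * tau x.
  near=> x; have hx : amin < x by near: x; exact: lt_nbhsr.
  by have [ht _] := tauP hx; exact: mulr_ge0 (ltW (alpha_gt0 hx)) (ltW ht).
have [_ h] := cvg_msq_corr ct cv pos (mulr_ge0 (ltW a00) (ltW t0)).
apply: cvgB => //; apply: cvgM => //; exact: cvg_cst.
Unshelve. all: by end_near.
Qed.

(** * Positive slope at a large penalty, small values near [alpha_min] *)

Lemma sqr_tau_ge a : amin < a -> s2 <= tau a ^+ 2.
Proof.
by move=> /tauP [_ ->]; rewrite lerDl; apply: divr_ge0; [exact: msq_ge0|exact: ltW].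
Qed.

(** As [tau >= s], [|X + tau Z| <= tau Y] with [Y] the same for all penalties. With penalty [n] the
    thresholded value vanishes unless [Y > n], so [corr / tau <= E[Y^2; Y > n]], which tends to
    0. *)
Lemma slope_gt0 : exists2 a, amin < a & 0 < slope a.
Proof.
pose s := Num.sqrt s2.
have sp : 0 < s by rewrite sqrtr_gt0.
pose Y w := s^-1 * `|X w| + `|Z w|.
have Y0 w : 0 <= Y w by rewrite addr_ge0// mulr_ge0// invr_ge0 ltW.
have hY : L2 P Y by rewrite /Y; l2.
have iY := integrable_sqr hY.
pose f (n : nat) w := if n%:R < Y w then Y w ^+ 2 else 0.
have mf n : measurable_fun setT (f n).
  apply: measurable_fun_ifT => //; last exact: measurable_funX (L2_measurable hY).
  by apply: measurable_fun_ltr => //; exact: L2_measurable hY.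
have fY n w : 0 <= f n w <= Y w ^+ 2.
  by rewrite /f; case: ifP => _; rewrite ?lexx ?sqr_ge0.
have intf n : P.-integrable setT (EFin \o f n).
  apply: (le_Rintegrable (mf n) _ iY) => w.
  by have /andP[f0 fle] := fY n w; rewrite ger0_norm.
have lim : \int[P]_w f n w @[n --> \oo] --> (0 : R).
  have [|||||_ _] := @dominated_convergence _ _ R P setT measurableT
     (fun n => EFin \o f n) (cst 0%E) (EFin \o (fun w => Y w ^+ 2)).
  - by move=> n; exact/measurable_EFinP.
  - exact: measurable_cst.
  - apply: aeW => w _; apply: cvg_near_cst; near=> n.
    rewrite /= /f ifF//; apply/negbTE; rewrite -leNgt; apply/ltW.
    by near: n; exact: nbhs_infty_gtr.
  - exact: iY.
  - apply: aeW => w n _; rewrite /= lee_fin.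
    by have /andP[f0 fle] := fY n w; rewrite ger0_norm.
  by rewrite integral0 => /fine_cvg.
have [n [an fn]] : exists n, amin < n%:R /\ \int[P]_w f n w < delta.
  apply: (@filter_ex _ \oo _ (fun n => amin < n%:R /\ \int[P]_w f n w < delta)).
  near=> n; split; first by near: n; exact: nbhs_infty_gtr.
  by near: n; exact: (cvgr_lt _ lim).
exists n%:R => //; have [t0 _] := tauP an.
have st : s <= tau n%:R.
  by rewrite -(@ler_pXn2r _ 2)// ?nnegrE ?(ltW sp) ?(ltW t0)// sqr_sqrtr ?sqr_tau_ge// ltW.
rewrite /slope /beta subr_gt0 ltr_pdivrMr//.
apply: (@le_lt_trans _ _ (tau n%:R * \int[P]_w f n w)); last by rewrite ltr_pM2l.
have th0 : 0 <= n%:R * tau n%:R by rewrite mulr_ge0// ltW.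
have he := L2_eta (tau n%:R) th0.
rewrite /corr -expectZ//; apply: le_expect; [by integ|by integ|move=> w].
apply: (le_trans (ler_norm _)); rewrite normrM norm_eta//.
have hxt : `|X w| <= tau n%:R * (s^-1 * `|X w|).
  by rewrite mulrA ler_peMl// ler_pdivlMr// mul1r.
have h1 : `|X w + tau n%:R * Z w| <= tau n%:R * Y w.
  apply: (le_trans (ler_normD _ _)).
  by rewrite normrM (gtr0_norm t0) /Y mulrDr lerD2r.
have h2 : `|Z w| <= Y w by rewrite /Y lerDr mulr_ge0// invr_ge0 ltW.
rewrite /f; case: ltP => hn.
  rewrite expr2 mulrCA; apply: ler_pM => //; first by rewrite le_max lexx orbT.
  rewrite ge_max mulr_ge0 ?(ltW t0)// andbT.
  lra.
rewrite max_r ?mulr0// subr_le0 (le_trans h1)// mulrC ler_wpM2r// ltW.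
Unshelve. all: by end_near.
Qed.

(** Optimality tested against the competitor 0, that is, [X] in place of [eta]; E[X Z] = 0 removes
    the cross term. The bound becomes negative when [tau] is large. *)
Lemma slope_le a : amin < a ->
  delta * slope a <= delta * s2 / tau a -
    a * (tau a * \int[P]_w Num.max (`|Z w| - a) 0 - 2 * \int[P]_w `|X w|).
Proof.
move=> ha; have [t0 e] := tauP ha; have a0 := alpha_gt0 ha.
set t := tau a in t0 e *.
have th0 : 0 <= a * t by rewrite mulr_ge0// ltW.
have he := L2_eta t th0; have hr := L2_resid t th0.
have irs := integrable_sqr hr.
have hm : L2 P (fun w => Num.max (`|Z w| - a) 0) by l2.
have h1 : msq t (a * t) + a * t * (mabs t (a * t) - \int[P]_w `|X w|) <= t * corr t (a * t).
  have -> : corr t (a * t) = \int[P]_w (Z w * eta (X w + t * Z w) (a * t) - X w * Z w).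
    by rewrite expectB; [rewrite XZ_uncorrelated subr0|by integ|by integ].
  rewrite /mabs -expectB; [|by integ|by integ].
  rewrite -!expectZ; [|by integ|by integ].
  rewrite -expectD; [|by integ|by integ].
  apply: le_expect; [by integ|by integ|move=> w].
  have := eta_prox (X w + t * Z w) (X w) th0.
  by move=> hp; rewrite -subr_ge0; move: hp; rewrite /resid; congr (0 <= _); ring.
have h2 : t * \int[P]_w Num.max (`|Z w| - a) 0 - \int[P]_w `|X w| <= mabs t (a * t).
  rewrite -expectZ; last by integ.
  rewrite -expectB; [|by integ|by integ].
  apply: le_expect; [by integ|by apply: integrable_normr; integ|move=> w].
  have h3 := eta_lipschitz (X w + t * Z w) (t * Z w) th0 th0.
  rewrite addrK subrr normr0 addr0 in h3.
  have h4 : `|eta (t * Z w) (a * t)| = t * Num.max (`|Z w| - a) 0.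
    by rewrite [a * t]mulrC eta_scale ?ltW// normrM norm_eta ?ltW// (gtr0_norm t0).
  rewrite -h4 lerBlDr -[eta (t * Z w) _](subKr (eta (X w + t * Z w) (a * t))).
  apply: (le_trans (ler_normB _ _)); lra.
rewrite -(ler_pM2l t0) /slope /beta -/t.
have -> : t * (delta * (t - corr t (a * t) / delta)) = delta * t ^+ 2 - t * corr t (a * t).
  by field; rewrite gt_eqF.
have -> : t * (delta * s2 / t - a * (t * \int[P]_w Num.max (`|Z w| - a) 0 - 2 * \int[P]_w `|X w|))
  = delta * s2 - a * t * (t * \int[P]_w Num.max (`|Z w| - a) 0 - 2 * \int[P]_w `|X w|).
  by field; rewrite gt_eqF.
have -> : delta * t ^+ 2 = delta * s2 + msq t (a * t) by rewrite e; field; rewrite gt_eqF.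
have h5 : a * t * (t * \int[P]_w Num.max (`|Z w| - a) 0 - 2 * \int[P]_w `|X w|) <=
    a * t * (mabs t (a * t) - \int[P]_w `|X w|).
  by rewrite ler_wpM2l//; lra.
lra.
Qed.

(** If [alpha_min = 0], the slope stays below [slope 1] and the factor [a] makes the product small.
    Otherwise the slope is at most 0 at some [a] close to [alpha_min], where [tau] is large. *)
Lemma slope_small l : 0 < l -> exists2 a, amin < a & a * slope a <= l.
Proof.
move=> l0; have := alpha_min_ge0 delta; rewrite le_eqVlt => /predU1P[am0|am0].
  have h1 : amin < 1 by rewrite -am0.
  pose a := Num.min 1 (l / (`|slope 1| + 1)).
  have a0 : 0 < a by rewrite lt_min ltr01 divr_gt0// ltr_wpDl.
  have ha : amin < a by rewrite -am0.
  exists a => //.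
  have a1 : a <= 1 by rewrite ge_min lexx.
  have a2 : a <= l / (`|slope 1| + 1) by rewrite ge_min lexx orbT.
  rewrite ler_pdivlMr ?ltr_wpDl// in a2.
  apply: le_trans a2; rewrite ler_wpM2l ?(ltW a0)//.
  apply: (le_trans (slope_nondecreasing ha a1)).
  by apply: (le_trans (ler_norm _)); rewrite lerDl.
pose m := \int[P]_w Num.max (`|Z w| - (amin + 1)) 0.
have m0 : 0 < m by exact: Z_abs_gt0.
pose EX := \int[P]_w `|X w|.
have EX0 : 0 <= EX by apply: expect_ge0 => w.
(* For [tau >= M] and [amin < a <= amin + 1], the subtracted term of [slope_le] is at least
   [delta * s2], and the first term is at most that because [M >= 1]. *)
pose M := 1 + (2 * EX + delta * s2 / amin) / m.
have ds0 : 0 < delta * s2 by rewrite mulr_gt0.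
have q0 : 0 < delta * s2 / amin by rewrite divr_gt0.
have M1 : 1 <= M.
  by rewrite lerDl; apply: divr_ge0; [apply: addr_ge0; [exact: mulr_ge0|exact: ltW]|exact: ltW].
have M2 : 2 * EX + delta * s2 / amin <= M * m.
  have -> : M * m = m + (2 * EX + delta * s2 / amin).
    by rewrite /M; field; rewrite !gt_eqF.
  by rewrite lerDr ltW.
have cr := @continuous_risk0 R amin.
rewrite /continuous_at risk0_alpha_min// in cr.
have [a [a1 [ha hr]]] : exists a, a <= amin + 1 /\ amin < a /\
    delta - delta * s2 / M ^+ 2 < risk0 a.
  apply: (@filter_ex _ (amin^'+) _ (fun a => a <= amin + 1 /\ amin < a /\
    delta - delta * s2 / M ^+ 2 < risk0 a)).
  near=> a; split; first by near: a; apply: nbhs_right_le; rewrite ltrDl.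
  split => //.
  near: a; apply: (cvgr_gt delta).
    exact: cvg_at_right_filter.
  by rewrite gtrBl divr_gt0// exprn_gt0// (lt_le_trans ltr01).
exists a => //; apply: le_trans (ltW l0); have a0 := alpha_gt0 ha.
rewrite pmulr_rle0// -(pmulr_rle0 _ delta0).
apply: (le_trans (slope_le ha)).
have [t0 e] := tauP ha; set t := tau a in t0 e *.
have rd := risk0_lt_delta delta0 ha.
(* The fixed-point equation and [msq_ge_risk0] give [delta * s2 <= (delta - risk0 a) * t^2], while
   [a] was chosen with [delta - risk0 a < delta * s2 / M^2]. *)
have tM : M <= t.
  have M0 : 0 <= M by lra.
  rewrite -(@ler_pXn2r _ 2)// ?nnegrE ?(ltW t0)//.
  have h1 := msq_ge_risk0 (ltW a0) (ltW t0).
  have h2 : msq t (a * t) = delta * (t ^+ 2 - s2) by rewrite e; field; rewrite gt_eqF.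
  have h3 : delta * s2 <= (delta - risk0 a) * t ^+ 2 by rewrite h2 in h1; lra.
  have h4 : delta * s2 <= delta * s2 / M ^+ 2 * t ^+ 2.
    by apply: (le_trans h3); rewrite ler_wpM2r ?sqr_ge0//; lra.
  have M20 : 0 < M ^+ 2 by rewrite exprn_gt0// (lt_le_trans ltr01).
  by rewrite mulrAC -mulrA ler_pMr// ler_pdivlMr// mul1r in h4.
have mm : m <= \int[P]_w Num.max (`|Z w| - a) 0.
  have hc c : L2 P (fun w => Num.max (`|Z w| - c) 0) by l2.
  apply: le_expect; [by integ|by integ|move=> w].
  by rewrite ge_max !le_max lexx !orbT andbT; apply/orP; left; lra.
have h6 : delta * s2 / t <= delta * s2.
  by rewrite ler_pdivrMr// ler_peMr// ?(ltW ds0)// (le_trans M1).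
have h7 : M * m <= t * \int[P]_w Num.max (`|Z w| - a) 0 by apply: ler_pM => //; lra.
have h8 : amin * (delta * s2 / amin) <= a * (t * \int[P]_w Num.max (`|Z w| - a) 0 - 2 * EX).
  by apply: ler_pM; lra.
rewrite mulrC divfK ?gt_eqF// in h8.
by rewrite -/EX; lra.
Unshelve. all: by end_near.
Qed.
End calibration.

(** * Inverting the calibration map *)

Section inverse.
Context (R : realType) (m : R) (f g : R -> R).
Hypothesis f_lt : forall a b, m < a -> a < b -> 0 < f a -> f a < f b.
Hypothesis gP : forall l, 0 < l -> m < g l /\ f (g l) = l.

(** Neither the position of [a] nor the sign of [f a] matters: were [g l < a], [f_lt] could be
    started at [g l], where [f] has the positive value [l]. *)
Let g_gt a l : 0 < l -> f a < l -> a < g l.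
Proof.
move=> l0 al; have [mg fg] := gP l0.
rewrite ltNge; apply/negP; rewrite le_eqVlt => /predU1P[e|h].
  by move: al; rewrite -e fg ltxx.
by have := f_lt mg h; rewrite fg => /(_ l0); rewrite ltNge ltW.
Qed.

Let g_lt b l : 0 < l -> m < b -> l < f b -> g l < b.
Proof.
move=> l0 mb lb; have [mg fg] := gP l0.
rewrite ltNge; apply/negP; rewrite le_eqVlt => /predU1P[e|h].
  by move: lb; rewrite e fg ltxx.
have := f_lt mb h; rewrite fg => /(_ (lt_trans l0 lb)).
by rewrite ltNge ltW.
Qed.

Let f_inj a l : 0 < l -> m < a -> f a = l -> g l = a.
Proof.
move=> l0 ma fa; have [mg fg] := gP l0.
case: (ltgtP (g l) a) => // h.
- by have := f_lt mg h; rewrite fa fg ltxx => /(_ l0).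
- by have := f_lt ma h; rewrite fa fg ltxx => /(_ l0).
Qed.

Lemma inverse_unique l : 0 < l -> exists! a, m < a /\ f a = l.
Proof.
move=> l0; exists (g l); split; first exact: gP.
by move=> a [ma fa]; exact: f_inj.
Qed.

Let g_incr k l : 0 < k -> k < l -> g k < g l.
Proof. by move=> k0 kl; have [ml fl] := gP (lt_trans k0 kl); apply: g_lt; rewrite ?fl. Qed.

Lemma inverse_homo : {in `]0, +oo[ &, {homo g : x y / x <= y}}.
Proof.
move=> k l; rewrite !in_itv/= !andbT => k0 _.
by rewrite le_eqVlt => /predU1P[->//|kl]; exact/ltW/g_incr.
Qed.

Lemma inverse_continuous : {within `]0, +oo[, continuous g}.
Proof.
apply: continuous_in_subspaceT => l; rewrite inE/= in_itv/= andbT => l0.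
have [ml fl] := gP l0.
apply/cvgrPdist_le => e e0.
have hi : l < f (g l + e) by rewrite -{1}fl; apply: f_lt; rewrite ?fl ?ltrDl.
have lo : m < g l - e -> f (g l - e) < l.
  move=> hm; have [h|h] := leP (f (g l - e)) 0; first exact: le_lt_trans h l0.
  have gl : g l - e < g l by rewrite gtrBl.
  by have := f_lt hm gl h; rewrite fl.
(* If [g l - e] falls to [m] or below, the lower bound on [g x] follows from [m < g x]; hence the
   guard. *)
have lo' : \forall x \near l, m < g l - e -> f (g l - e) < x.
  have [hm|hm] := ltP m (g l - e); last first.
    by apply: (@filterS _ _ _ setT) filterT.
  by apply: filterS (lt_nbhsr (lo hm)).
near=> x.
have x0 : 0 < x by near: x; exact: lt_nbhsr.
have xhi : g x < g l + e.
  apply: g_lt => //; first by rewrite (lt_trans ml)// ltrDl.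
  by near: x; exact: lt_nbhsl.
have xlo : g l - e < g x.
  have [hm|hm] := leP (g l - e) m; first by apply: (le_lt_trans hm); have [] := gP x0.
  by apply: g_gt => //; move: hm; near: x; exact: lo'.
by rewrite ler_norml; lra.
Unshelve. all: by end_near.
Qed.

(** The image is closed upwards, as [b > g l] gives [f b > l > 0] and [b = g (f b)]. It omits its
    infimum because [g (l / 2) < g l]. *)
Lemma inverse_image : exists a0, g @` `]0, +oo[ = `]a0, +oo[%classic.
Proof.
pose S := g @` `]0, +oo[%classic.
have lb : lbound S m.
  by move=> y [l] /=; rewrite in_itv/= andbT => l0 <-; have [/ltW] := gP l0.
have hS : has_inf S.
  split; last by exists m.
  by exists (g 1), 1 => //=; rewrite in_itv/= andbT.
exists (inf S); apply/seteqP; split => b /=.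
- move=> [l]; rewrite /= !in_itv/= !andbT => l0 <-.
  have l2 : 0 < l / 2 by rewrite divr_gt0.
  apply: (@le_lt_trans _ _ (g (l / 2))); last by apply: g_incr => //; lra.
  apply: ge_inf; first by exists m.
  by exists (l / 2) => //=; rewrite in_itv/= l2.
- rewrite in_itv/= andbT => hb.
  have hb' : 0 < b - inf S by rewrite subr_gt0.
  have [_ [l /= + <-]] := inf_adherent hb' hS.
  rewrite in_itv/= andbT => l0; rewrite addrC subrK => gb.
  have [ml fl] := gP l0.
  have fb : l < f b by rewrite -{1}fl; apply: f_lt; rewrite ?fl.
  have fb0 := lt_trans l0 fb.
  exists (f b); first by rewrite /= in_itv/= fb0.
  by apply: f_inj => //; exact: lt_trans gb.
Qed.
End inverse.

(** * The calibration map for the given laws *)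

Section alpha_lambda.
Context (R : realType) (delta : R) (pX0 : probability R R).
Context (d : measure_display) (Omega : measurableType d) (P : probability Omega R).
Variables (X0 Z : {RV P >-> R}) (s2 : R).
Hypotheses (delta_gt0 : 0 < delta) (s2_gt0 : 0 < s2).
Hypothesis pX0_moment2 : (\int[pX0]_x (x ^+ 2)%:E < +oo)%E.
Hypothesis X0_law : forall A : set R, measurable A -> distribution P X0 A = pX0 A.
Hypothesis Z_law : forall A : set R, measurable A ->
      distribution P Z A = normal_prob 0 1 A.
Hypothesis indep : independent_RV X0 Z.
Local Notation N := (normal_prob (0 : R) 1).

Let hZ : L2 P Z.
Proof. exact: L2_Z Z_law. Qed.

Let hX : L2 P X0.
Proof.
split => //.
have H := @integrable_law _ _ _ _ R P pX0 X0 (measurable_funPT X0) X0_law (fun z => z ^+ 2).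
apply H; first exact: measurable_funX.
apply/integrableP; split; first by apply/measurable_EFinP; exact: measurable_funX.
by under eq_integral => x _ do rewrite /= ger0_norm ?sqr_ge0//.
Qed.

Let expect_Z (h : R -> R) : measurable_fun setT h ->
  N.-integrable setT (EFin \o h) -> \int[P]_w h (Z w) = \int[N]_z h z.
Proof.
move=> mh ih; have mZ := measurable_funPT Z.
apply: (@expect_law _ _ _ _ R P N Z mZ Z_law h mh).
exact/(@integrable_law _ _ _ _ R P N Z mZ Z_law h mh).
Qed.

Let L2_pos (a : R) := @L2_pos_norm R a.

Let Z_risk0 (a : R) : 0 <= a -> \int[P]_w Num.max (`|Z w| - a) 0 ^+ 2 = risk0 a.
Proof.
move=> a0; have h := L2_pos a.
apply: (expect_Z (h := fun z => Num.max (`|z| - a) 0 ^+ 2)); last exact: integrable_sqr.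
by apply: measurable_funX; exact: L2_measurable h.
Qed.

Let Z_abs_gt0 (a : R) : 0 < \int[P]_w Num.max (`|Z w| - a) 0.
Proof.
have h := L2_pos a.
rewrite (expect_Z (h := fun z => Num.max (`|z| - a) 0)); last by integ.
  exact: expect_abs_gt0.
exact: L2_measurable h.
Qed.

Let XZ_uncorrelated : \int[P]_w (X0 w * Z w) = 0.
Proof.
have iid := @L2_id_normal R.
apply: (@expect_pair_eq0 _ _ _ _ _ _ _ P pX0 N X0 Z (measurable_funPT X0) (measurable_funPT Z) _ (fun u => u.1 * u.2)).
- by move=> A B mA mB; rewrite indep//; congr (_ * _)%E; [exact: X0_law|exact: Z_law].
- exact: measurable_funM.
- by integ.
- by move=> x; apply: integrableZl_EFin; integ.
- by move=> x; rewrite /= expectZ ?expect_normal_id ?mulr0//; integ.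
Qed.

Local Notation amin := (alpha_min delta).
Local Notation tau_ := (tau P X0 Z delta s2).
Local Notation slope_ := (slope P X0 Z delta s2).

Let F_msq t th : 0 <= t -> F X0 Z delta s2 (t ^+ 2) th = s2 + msq P X0 Z t th / delta.
Proof.
move=> t0; rewrite /F mulrC unlock; congr (_ + _ * _).
by congr fine; apply: eq_integral => w _; rewrite sqrtr_sqr ger0_norm.
Qed.

Let tau_starE a : tau_star X0 Z delta s2 a = tau_ a.
Proof.
rewrite /tau_star /tau; congr xget; apply/seteqP; split => t /=.
- move=> [t0]; rewrite F_msq// => e; split => //.
  rewrite lt_neqAle t0 andbT; apply/eqP => t00.
  have : 0 < t ^+ 2.
    by rewrite e ltr_pwDl//; apply: divr_ge0; [exact: msq_ge0|exact: ltW].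
  by rewrite -t00 expr0n ltxx.
- by move=> [t0 e]; split; [exact: ltW|rewrite F_msq// ltW].
Qed.

(** Stein's identity turns [corr] into [tau * E eta'], so that [tau] factors out of [slope]. *)
Let lambda_ofE a : amin < a -> lambda_of X0 Z delta s2 a = a * slope_ a.
Proof.
move=> ha; rewrite /lambda_of tau_starE /slope /beta /corr.
have [t0 _] := tauP hX hZ delta_gt0 s2_gt0 Z_risk0 ha.
have a0 : 0 < a by apply: le_lt_trans ha; exact: alpha_min_ge0.
rewrite (stein X0_law Z_law indep t0)//; last by rewrite mulr_ge0// ltW.
rewrite unlock -mulrA; congr (_ * _).
by rewrite /Rintegral; field; rewrite gt_eqF.
Qed.

Let slope_homo := slope_nondecreasing hX hZ delta_gt0 s2_gt0 Z_risk0.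

(** Strictness comes from the factor [alpha], which may be enlarged because the slope at [a] is
    positive. *)
Lemma lambda_of_lt a b : amin < a -> a < b -> 0 < lambda_of X0 Z delta s2 a ->
  lambda_of X0 Z delta s2 a < lambda_of X0 Z delta s2 b.
Proof.
move=> ha ab; have hb := lt_trans ha ab.
have a0 : 0 < a by apply: le_lt_trans ha; exact: alpha_min_ge0.
rewrite (lambda_ofE ha) (lambda_ofE hb) pmulr_rgt0// => sa.
apply: (@lt_le_trans _ _ (b * slope_ a)); first by rewrite ltr_pM2r.
have b0 : 0 < b by exact: lt_trans ab.
by rewrite (ler_pM2l b0); exact: slope_homo ha (ltW ab).
Qed.

Let lambda_surj l : 0 < l ->
  exists a, amin < a /\ lambda_of X0 Z delta s2 a = l.
Proof.
move=> l0.
have [a ha al] := slope_small hX hZ delta_gt0 s2_gt0 Z_risk0 Z_abs_gt0 XZ_uncorrelated l0.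
have [b hb b0] := slope_gt0 hX hZ delta_gt0 s2_gt0 Z_risk0.
(* Beyond [b] the slope is at least [slope_ b > 0], so a factor of at least [l / slope_ b] brings
   the product up to [l]. *)
pose c := Num.max a (Num.max b (l / slope_ b)).
have ac : a <= c by rewrite le_max lexx.
have bc : b <= c by rewrite !le_max lexx !orbT.
have hc := lt_le_trans ha ac.
have c0 : 0 < c by apply: le_lt_trans hc; exact: alpha_min_ge0.
have lc : l <= c * slope_ c.
  apply: (@le_trans _ _ (c * slope_ b)).
    by rewrite -ler_pdivrMr// !le_max lexx !orbT.
  by rewrite (ler_pM2l c0); exact: slope_homo hb bc.
have [||x] := @IVT R (fun x => x * slope_ x) a c l ac.
- apply: continuous_in_subspaceT => x; rewrite inE/= in_itv/= => /andP[ax _].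
  apply: cvgM; first exact: cvg_id.
  exact: (cvg_slope hX hZ delta_gt0 s2_gt0 Z_risk0 (lt_le_trans ha ax)).
- by rewrite ge_min le_max; apply/andP; split; apply/orP; [left; exact: al|right; exact: lc].
rewrite in_itv/= => /andP[ax _] hx; exists x.
by have hx' := lt_le_trans ha ax; rewrite (lambda_ofE hx').
Qed.

Lemma alpha_ofP l : 0 < l -> amin < alpha_of X0 Z delta s2 l /\
  lambda_of X0 Z delta s2 (alpha_of X0 Z delta s2 l) = l.
Proof.
move=> /lambda_surj [a ha]; rewrite /alpha_of.
exact: (@xgetPex _ 0 [set a | amin < a /\ lambda_of X0 Z delta s2 a = l]) (ex_intro _ a ha).
Qed.
End alpha_lambda.

Theorem corollary1p7 (R : realType) (delta : R) (delta_gt0 : 0 < delta)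
    (pX0 : probability R R)
    (pX0_moment2 : (\int[pX0]_x (x ^+ 2)%:E < +oo)%E)
    (d : measure_display) (Omega : measurableType d) (P : probability Omega R)
    (X0 Z : {RV P >-> R})
    (X0_law : forall A : set R, measurable A -> distribution P X0 A = pX0 A)
    (Z_law : forall A : set R, measurable A ->
      distribution P Z A = normal_prob 0 1 A)
    (X0_Z_indep : independent_RV X0 Z)
    (sigma2 : R) (sigma2_gt0 : 0 < sigma2) :
  (forall lambda : R, 0 < lambda ->
     exists! alpha : R, alpha_min delta < alpha /\
                        lambda_of X0 Z delta sigma2 alpha = lambda) /\
  [/\ {within `]0, +oo[, continuous (alpha_of X0 Z delta sigma2)},
      {in `]0, +oo[ &, {homo alpha_of X0 Z delta sigma2 : x y / x <= y}} &
      exists alpha0 : R,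
        alpha_of X0 Z delta sigma2 @` `]0, +oo[ = `]alpha0, +oo[%classic].
Proof.
have lt := lambda_of_lt delta_gt0 sigma2_gt0 pX0_moment2 X0_law Z_law X0_Z_indep.
have aP := alpha_ofP delta_gt0 sigma2_gt0 pX0_moment2 X0_law Z_law X0_Z_indep.
split; first by move=> l; exact: (inverse_unique lt aP).
split.
- exact: (inverse_continuous lt aP).
- exact: (inverse_homo lt aP).
- exact: (inverse_image lt aP).
Qed.
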